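(* Let $\Bbbk$ be an algebraically closed field of characteristic $p>2$ and let $\Psi_\Bbbk:Y_2^>(\Bbbk)\to W^{(2)}(\Bbbk)$ be the $\Bbbk$-algebra homomorphism with $e_r\mapsto x_1^r$. Then $$\mathrm{im}(\Psi_\Bbbk)=\bigoplus_{k\in\mathbb{N}}\{f\in\Bbbk[x_1,\dots,x_k]^{\Sigma_k}:\ f=0\text{ whenever }x_1=x_2+1=\dots=x_p+p-1\}$$ (the condition being vacuous for $k<p$), and the polynomials $P_\lambda$, with $\lambda$ ranging over all $p$-restricted partitions (of all lengths $k\in\mathbb{N}$), form a $\Bbbk$-basis of $\mathrm{im}(\Psi_\Bbbk)$.
   Context: $\mathbb{N}=\{0,1,\dots\}$. $Y_2^>(\Bbbk)$ is the $\Bbbk$-algebra generated by $e_r$ ($r\in\mathbb{N}$) with relations $[e_{r+1},e_s]-[e_r,e_{s+1}]=e_re_s+e_se_r$. $W^{(2)}(\Bbbk)=\bigoplus_kW^{(2)}_k(\Bbbk)$, $W^{(2)}_k(\Bbbk)=\Bbbk[x_1,\dots,x_k]^{\Sigma_k}$, with product $F\star G=\sum_\sigma\sigma\big(F(x_1,\dots,x_k)G(x_{k+1},\dots,x_{k+\ell})\prod_{r\le k<r'}\frac{x_r-x_{r'}+1}{x_r-x_{r'}}\big)$ for $F\in W_k,G\in W_\ell$, over $\sigma\in\Sigma_{k+\ell}$ increasing on $\{1..k\}$ and on $\{k+1..k+\ell\}$. A partition of length $k$ is $\lambda=(\lambda_1\ge\dots\ge\lambda_k)$, $\lambda_i\in\mathbb{N}$;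 $m_i(\lambda)=\#\{j:\lambda_j=i\}$; $\lambda$ is $p$-restricted if all $m_i(\lambda)<p$; $\mathrm{mul}(\lambda)=\prod_{i\ge1}m_i(\lambda)!$; $P_\lambda=\frac{1}{\mathrm{mul}(\lambda)}\sum_{\sigma\in\Sigma_k}\sigma\big(x_1^{\lambda_1}\cdots x_k^{\lambda_k}\prod_{i<j}\frac{x_i-x_j+1}{x_i-x_j}\big)\in\Bbbk[x_1,\dots,x_k]^{\Sigma_k}$ (the symmetrization is an integer-coefficient polynomial reduced to $\Bbbk$). *)

(* Defs.v *)
From HB Require Import structures.
From mathcomp Require Import all_boot all_order all_algebra all_fingroup.
From mathcomp Require Import fraction mpoly.
Set Implicit Arguments. Unset Strict Implicit. Unset Printing Implicit Defensive.
Import Order.TTheory GRing.Theory.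
Local Open Scope ring_scope.

Notation tofrac := (@FracField.tofrac _).

(* The shuffle algebra W^(2)(K) = (+)_k K[x_1..x_k]^{S_k}.  Its degree-k   *)
(* component is (the symmetric part of) {mpoly K[k]}; variables are        *)
(* 0-indexed, so x_{i+1} is 'X_i.                                          *)
Section Shuffle.
Variable K : fieldType.

Definition is_shuffle (k l : nat) (s : 'S_(k + l)) : bool :=
  [forall i : 'I_k, forall j : 'I_k,
      (i < j)%N ==> (s (lshift l i) < s (lshift l j))%N] &&
  [forall i : 'I_l, forall j : 'I_l,
      (i < j)%N ==> (s (rshift k i) < s (rshift k j))%N].

Definition embL (k l : nat) (F : {mpoly K[k]}) : {mpoly K[k + l]} :=
  F \mPo [tuple 'X_(lshift l i) | i < k].
Definition embR (k l : nat) (G : {mpoly K[l]}) : {mpoly K[k + l]} :=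
  G \mPo [tuple 'X_(rshift k i) | i < l].

Definition crossN (k l : nat) : {mpoly K[k + l]} :=
  \prod_(i < k) \prod_(j < l) ('X_(lshift l i) - 'X_(rshift k j) + 1).
Definition crossD (k l : nat) : {mpoly K[k + l]} :=
  \prod_(i < k) \prod_(j < l) ('X_(lshift l i) - 'X_(rshift k j)).

(* F * G computed in the fraction field of K[x_1..x_{k+l}]; sigma acts on a  *)
(* fraction N/D by sigma(N)/sigma(D), with sigma(x_i) = x_{sigma(i)}.       *)
Definition star_frac (k l : nat) (F : {mpoly K[k]}) (G : {mpoly K[l]})
  : {fraction {mpoly K[k + l]}} :=
  \sum_(s : 'S_(k + l) | is_shuffle s)
     (tofrac (msym s (embL l F * embR k G * crossN k l))) / (tofrac (msym s (crossD k l))).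

Definition is_star (k l : nat) (F : {mpoly K[k]}) (G : {mpoly K[l]})
  (H : {mpoly K[k + l]}) : Prop := tofrac H = star_frac F G.

Definition psi_closed (S : forall n : nat, {mpoly K[n]} -> Prop) : Prop :=
  [/\ S 0%N 1,
      (forall r : nat, S 1%N ('X_ord0 ^+ r)) &
      (forall n, S n 0)] /\
  [/\       (forall n (f g : {mpoly K[n]}), S n f -> S n g -> S n (f + g)),
      (forall n (c : K) (f : {mpoly K[n]}), S n f -> S n (c *: f)) &
      (forall k l (F : {mpoly K[k]}) (G : {mpoly K[l]}) (H : {mpoly K[k + l]}),
          S k F -> S l G -> is_star F G H -> S (k + l)%N H)].

(* degree-n component of im(Psi_K) = subalgebra of W^(2)(K) generated by   *)
(* the x_1^r = Psi_K(e_r) (which is graded, the generators being homogeneous) *)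
Definition imPsi (n : nat) (f : {mpoly K[n]}) : Prop :=
  forall S, psi_closed S -> S n f.

Definition vanish_cond (p k : nat) (f : {mpoly K[k]}) : Prop :=
  (p <= k)%N ->
  forall v : 'I_k -> K,
    (forall i j : 'I_k, (i < p)%N -> (j < p)%N -> v i + i%:R = v j + j%:R) ->
    meval v f = 0.

End Shuffle.

Definition is_partition (k : nat) (lam : seq nat) : bool :=
  (size lam == k) && sorted geq lam.

Definition p_restricted (p : nat) (lam : seq nat) : bool :=
  all (fun i => count_mem i lam < p)%N lam.

Definition mulp (lam : seq nat) : nat :=
  (\prod_(i <- undup lam | i != 0%N) (count_mem i lam)`!)%N.

Definition is_PZ (k : nat) (lam : seq nat) (H : {mpoly int[k]}) : Prop :=
  (tofrac ((mulp lam)%:R * H)) =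
  \sum_(s : 'S_k)
    tofrac (msym s ((\prod_(i < k) 'X_i ^+ nth 0%N lam i) *
             \prod_(i < k) \prod_(j < k | (i < j)%N) ('X_i - 'X_j + 1))) /
    tofrac (msym s (\prod_(i < k) \prod_(j < k | (i < j)%N) ('X_i - 'X_j))).

Definition redK (K : fieldType) (k : nat) (H : {mpoly int[k]}) : {mpoly K[k]} :=
  map_mpoly (fun z : int => z%:~R) H.

(* Main.v *)
(* Write [vdm] for prod_(i<j) (x_i - x_j), [vdm1] for prod_(i<j) (x_i - x_j + 1), and
   [alt g] for the sum of sgn(s) s(g) over all permutations s.  Clearing denominators
   turns the shuffle product into alternation: if F vdm = alt (f vdm1) and
   G vdm = alt (g vdm1) then (F * G) vdm = alt ((f (x) g) vdm1), because every
   permutation is uniquely a block permutation followed by a shuffle.  Hence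
   mul(lam) P_lam is the product e_(lam_1) ... e_(lam_k), and every f in the image
   satisfies f vdm = alt (g vdm1) for some g; f then vanishes on the wheel locus, since
   for each s some factor of s(vdm1) vanishes at its generic point while vdm does not.

   Conversely, let f be symmetric and vanish on the wheel locus, and let m be a monomial
   of top degree.  If p exponents of m coincide, then the coefficient of m is 0: compare
   top-degree coefficients after substituting x_i := x_1 - (i - 1) for i <= p, and use
   that the non-constant orbits of the cyclic rotation of p exponents have p elements.
   As P_lam is a unit multiple of the monomial symmetric function m_lam modulo lower
   degree when lam is p-restricted, induction on the degree writes f as a combination
   of such P_lam; the same leading terms give linear independence. *)
Require Import Defs.
From HB Require Import structures.
From mathcomp Require Import all_boot all_order all_algebra all_fingroup.
From mathcomp Require Import all_solvable fraction mpoly ring.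
Import GRing.Theory.
Local Open Scope ring_scope.
Set Implicit Arguments. Unset Strict Implicit. Unset Printing Implicit Defensive.

(** * Alternating polynomials and the Vandermonde product *)

Section GenVandermonde.
Variable R : comNzRingType.

Lemma horner_sub_factor (q : {poly R}) (a : R) :
  exists r : {poly R}, forall x, q.[x] - q.[a] = r.[x] * (x - a).
Proof.
have /factor_theorem[r Er]: root (q - q.[a]%:P) a.
  by rewrite rootE !hornerE subrr.
by exists r => x; have /(congr1 (horner^~ x)) := Er; rewrite !hornerE.
Qed.

(** Subtracting row 0 from every other row makes row [i] divisible by [x i - x ord0]; expanding
    along row 0 then leaves minors of the same shape in the quotients [r]. Nothing is cancelled, so
    this works over any commutative ring. *)
Lemma det_horner_dvd n (q : 'I_n -> {poly R}) (x : 'I_n -> R) :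
  exists c, \det (\matrix_(i, j) (q j).[x i]) =
    c * \prod_(i < n) \prod_(j < n | (i < j)%N) (x i - x j).
Proof.
elim: n q x => [|n IHn] q x; first by exists 1; rewrite det_mx00 big_ord0 mulr1.
have /fin_all_exists[r Er] j : exists r : {poly R}, forall y,
    (q j).[y] - (q j).[x ord0] = r.[y] * (y - x ord0) by apply: horner_sub_factor.
have /fin_all_exists[c Ec] (j : 'I_n.+1) := IHn (fun k => r (lift j k)) (fun i => x (lift ord0 i)).
(* The row reduction as a factorization: [L] adds row 0 to every other row, and [d] holds the
   factors pulled out of the rows. *)
pose d i : R := if i == ord0 then 1 else x i - x ord0.
pose B := \matrix_(i, j) (if i == ord0 then (q j).[x ord0] else (r j).[x i]) : 'M[R]_n.+1.
pose L : 'M[R]_n.+1 := \matrix_(i, j) ((i == j)%:R + ((i != ord0) && (j == ord0))%:R).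
have detL : \det L = 1.
  rewrite det_trig; last first.
    apply/forallP=> i; apply/forallP=> j; apply/implyP=> ltij.
    rewrite mxE -val_eqE (ltn_eqF ltij) add0r.
    by rewrite -[j == _]val_eqE /= -[nat_of_ord j == _]negbK -lt0n (leq_ltn_trans _ ltij) // andbF.
  rewrite big1 // => i _; rewrite mxE eqxx.
  by case: (altP (i =P ord0)); rewrite /= addr0.
have EA : \matrix_(i, j) (q j).[x i] = L *m (diag_mx (\row_i d i) *m B).
  apply/matrixP=> i j; rewrite mul_diag_mx !mxE.
  under eq_bigr => k _ do rewrite !mxE mulrDl.
  rewrite big_split /= (bigD1 i) //= eqxx mul1r big1 ?addr0; last first.
    by move=> k /negPf; rewrite eq_sym => ->; rewrite mul0r.
  rewrite (bigD1 ord0) //= big1 ?addr0; last first.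
    by move=> k /negPf ->; rewrite andbF mul0r.
  rewrite eqxx andbT /d eqxx; case: (altP (i =P ord0)) => [->|_] /=.
    by rewrite mul0r mul1r addr0.
  by rewrite !mul1r mulrC -Er subrK.
have [e Ee] : exists e, \det B =
    e * \prod_(i < n) \prod_(k < n | (i < k)%N) (x (lift ord0 i) - x (lift ord0 k)).
  exists (\sum_j (q j).[x ord0] * ((-1) ^+ (@ord0 n + j) * c j)).
  rewrite (expand_det_row _ ord0) mulr_suml; apply: eq_bigr => j _.
  rewrite mxE eqxx -!mulrA -Ec /cofactor; congr (_ * (_ * \det _)).
  by apply/matrixP=> a b; rewrite !mxE eq_sym (negPf (neq_lift _ _)).
have Ed : \prod_i d i = (-1) ^+ n * \prod_(j < n.+1 | (@ord0 n < j)%N) (x ord0 - x j).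
  rewrite big_ord_recl /d eqxx mul1r [in RHS]big_mkcond big_ord_recl /= mul1r.
  rewrite -[n in _ ^+ n]card_ord -prodr_const -big_split /=.
  by apply: eq_bigr => i _; rewrite mulN1r opprB.
exists ((-1) ^+ n * e); rewrite EA !det_mulmx detL mul1r Ee det_diag.
under eq_bigr do rewrite mxE.
rewrite Ed [in RHS]big_ord_recl -!mulrA; congr (_ * _); rewrite mulrCA; congr (_ * (_ * _)).
apply: eq_bigr => i _; rewrite big_mkcond [in RHS]big_mkcond [in RHS]big_ord_recl /= mul1r.
by [].
Qed.

End GenVandermonde.

Section Alternation.
Variables (R : comNzRingType).
Implicit Types n : nat.

Definition vdm n : {mpoly R[n]} :=
  \prod_(i < n) \prod_(j < n | (i < j)%N) ('X_i - 'X_j).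

Definition vdm1 n : {mpoly R[n]} :=
  \prod_(i < n) \prod_(j < n | (i < j)%N) ('X_i - 'X_j + 1).

Definition alt n (g : {mpoly R[n]}) : {mpoly R[n]} :=
  \sum_(s : 'S_n) (-1) ^+ s * msym s g.

Lemma alt_is_additive n : additive (@alt n).
Proof.
by move=> f g; rewrite /alt -sumrB; apply: eq_bigr => s _; rewrite msymB mulrBr.
Qed.

HB.instance Definition _ n :=
  GRing.isAdditive.Build {mpoly R[n]} {mpoly R[n]} (@alt n) (@alt_is_additive n).

Lemma altZ n (c : R) (g : {mpoly R[n]}) : alt (c *: g) = c *: alt g.
Proof.
by rewrite /alt scaler_sumr; apply: eq_bigr => s _; rewrite msymZ scalerAr.
Qed.

Lemma msymXi n (s : 'S_n) i : msym s ('X_i : {mpoly R[n]}) = 'X_(s i).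
Proof. by rewrite /msym mmapX mmap1U. Qed.

Lemma msym_sign n (s : 'S_n) (b : bool) : msym s ((-1) ^+ b : {mpoly R[n]}) = (-1) ^+ b.
Proof. by rewrite rmorph_sign. Qed.

Lemma msym_alt n (s : 'S_n) (g : {mpoly R[n]}) : msym s (alt g) = (-1) ^+ s * alt g.
Proof.
rewrite /alt linear_sum mulr_sumr [RHS](reindex_inj (mulIg s)) /=.
apply: eq_bigr => t _; rewrite msymMm msymM msym_sign mulrA; congr (_ * _).
by rewrite odd_permM signr_addb mulrCA -expr2 sqrr_sign mulr1.
Qed.

(** Permuting the variables permutes the columns of a Vandermonde matrix, which multiplies its
    determinant by the sign. *)
Lemma msym_vdm n (s : 'S_n) : msym s (vdm n) = (-1) ^+ s * vdm n.
Proof.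
(* [det_Vandermonde] takes the differences in the opposite order; the resulting constant sign is the
   same on both sides. *)
have flip (x : 'I_n -> {mpoly R[n]}) :
    \prod_(i < n) \prod_(j < n | (i < j)%N) (x i - x j) =
    (\prod_(i < n) \prod_(j < n | (i < j)%N) -1) * \det (Vandermonde n (\row_j x j)).
  rewrite det_Vandermonde -big_split; apply: eq_bigr => i _ /=.
  by rewrite -big_split; apply: eq_bigr => j _ /=; rewrite !mxE mulN1r opprB.
rewrite [in RHS]/vdm (flip (fun i => 'X_i)).
transitivity (\prod_(i < n) \prod_(j < n | (i < j)%N) ('X_(s i) - 'X_(s j) : {mpoly R[n]})).
  rewrite rmorph_prod; apply: eq_bigr => i _; rewrite rmorph_prod; apply: eq_bigr => j _.
  by rewrite rmorphB /= !msymXi.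
rewrite (flip (fun i => 'X_(s i))) mulrCA; congr (_ * _).
have -> : Vandermonde n (\row_j 'X_(s j)) =
    col_perm s (Vandermonde n (\row_j ('X_j : {mpoly R[n]}))).
  by apply/matrixP=> i j; rewrite !mxE.
by rewrite col_permE det_mulmx det_perm odd_permV mulrC.
Qed.

(** [vdm] is itself alternating, so the signs cancel and a plain symmetrization remains; this is the
    source of the leading terms below. *)
Lemma alt_vdmM n (g : {mpoly R[n]}) : alt (vdm n * g) = vdm n * \sum_(s : 'S_n) msym s g.
Proof.
rewrite /alt mulr_sumr; apply: eq_bigr => s _; rewrite msymM msym_vdm mulrA mulrA.
by rewrite -expr2 sqrr_sign mul1r.
Qed.

(** The alternation of a monomial is a determinant of powers of the variables, to which
    [det_horner_dvd] applies. *)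
Lemma alt_dvd_vdm n (g : {mpoly R[n]}) : exists c, alt g = c * vdm n.
Proof.
elim/mpolyind: g => [|c m g _ _ [d Ed]]; first by exists 0; rewrite mul0r raddf0.
rewrite raddfD /= altZ Ed.
suff [e ->]: exists e, alt 'X_[m] = e * vdm n.
  by exists (c *: e + d); rewrite mulrDl scalerAl.
have [e Ee] := det_horner_dvd (fun j : 'I_n => 'X^(m j)) (fun i => 'X_i : {mpoly R[n]}).
exists e; rewrite -Ee -det_tr /alt; apply: eq_bigr => s _; congr (_ * _).
rewrite mpolyXE_id rmorph_prod; apply: eq_bigr => i _.
by rewrite rmorphXn /= msymXi !mxE hornerXn.
Qed.

End Alternation.

(** * Shuffles and block permutations *)

Section Standardization.
Variables (n : nat) (f : 'I_n -> nat).

(** Each index is sent to its rank, the number of smaller values of [f]. *)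
Lemma standardization_exists : injective f ->
  exists s : 'S_n, forall i j, (s i < s j)%N = (f i < f j)%N.
Proof.
move=> injf; pose r i := #|[set j | (f j < f i)%N]|.
have ltr i : (r i < n)%N.
  rewrite -[n in leqRHS]card_ord -cardsT; apply/proper_card/properP; split; first exact: subsetT.
  by exists i; rewrite ?inE ?ltnn.
have r_mono i j : (f i < f j)%N -> (r i < r j)%N.
  move=> ltij; apply/proper_card/properP; split.
    by apply/subsetP=> a; rewrite !inE => /ltn_trans->.
  by exists i; rewrite inE ?ltnn.
have rE i j : (r i < r j)%N = (f i < f j)%N.
  case: (ltngtP (f i) (f j)) => [/r_mono // |/r_mono/ltnW| /injf->]; last by rewrite ltnn.
  by rewrite leqNgt => /negPf.
have injr : injective (fun i => Ordinal (ltr i)).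
  move=> i j [] /eqP; rewrite eqn_leq [(r i <= _)%N]leqNgt [(r j <= _)%N]leqNgt !rE -!leqNgt.
  by rewrite -eqn_leq => /eqP/injf.
by exists (perm injr) => i j; rewrite !permE /= rE.
Qed.

Lemma standardization_unique (s t : 'S_n) :
  (forall i j, (s i < s j)%N = (f i < f j)%N) ->
  (forall i j, (t i < t j)%N = (f i < f j)%N) -> s = t.
Proof.
have rank_perm (u : 'S_n) i : #|[set j | (u j < u i)%N]| = u i.
  rewrite -(card_imset _ (@perm_inj _ u)).
  have -> : u @: [set j | (u j < u i)%N] = [set j : 'I_n | (j < u i)%N].
    apply/setP=> j; rewrite inE; apply/imsetP/idP => [[a]|ltj]; first by rewrite inE => ? ->.
    by exists (u^-1%g j); rewrite ?inE permKV.
  by rewrite -sum1dep_card -(big_ord_widen _ (fun=> 1%N) (ltnW (ltn_ord (u i)))) sum1_card card_ord.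
move=> Hs Ht; apply/permP=> i; apply: val_inj; rewrite -[LHS]rank_perm -[RHS]rank_perm.
by apply: eq_card => j; rewrite !inE Hs Ht.
Qed.

End Standardization.

Lemma increasing_lt n (f : 'I_n -> nat) :
  (forall i j : 'I_n, (i < j)%N -> (f i < f j)%N) ->
  forall i j : 'I_n, (i < j)%N = (f i < f j)%N.
Proof.
move=> incf i j; case: (ltngtP i j) => [/incf-> // |/incf/ltnW|/val_inj->]; last by rewrite ltnn.
by rewrite leqNgt => /negPf.
Qed.

Section BlockPerm.
Variables k l : nat.

Definition block_perm_fun (s : 'S_k) (t : 'S_l) (i : 'I_(k + l)) : 'I_(k + l) :=
  match split i with inl a => lshift l (s a) | inr b => rshift k (t b) end.

Lemma block_perm_fun_inj s t : injective (block_perm_fun s t).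
Proof.
move=> i j; rewrite /block_perm_fun.
case: (split_ordP i) => a ->; case: (split_ordP j) => b -> /eqP.
- by rewrite eq_lshift => /eqP/perm_inj->.
- by rewrite eq_lrshift.
- by rewrite eq_rlshift.
- by rewrite eq_rshift => /eqP/perm_inj->.
Qed.

Definition block_perm s t : 'S_(k + l) := perm (@block_perm_fun_inj s t).

Lemma block_permL s t i : block_perm s t (lshift l i) = lshift l (s i).
Proof. by rewrite permE /block_perm_fun (unsplitK (inl i)). Qed.

Lemma block_permR s t i : block_perm s t (rshift k i) = rshift k (t i).
Proof. by rewrite permE /block_perm_fun (unsplitK (inr i)). Qed.

(** The permutation matrix of [block_perm s t] is block diagonal, and signs are determinants of
    permutation matrices. *)
Lemma block_perm_sign (R : comNzRingType) s t :
  (-1) ^+ (block_perm s t) = (-1) ^+ s * (-1) ^+ t :> R.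
Proof.
rewrite -!det_perm -(det_ublock _ 0); congr (\det _); apply/matrixP => i j.
rewrite !mxE; case: (split_ordP i) => a ->; rewrite ?block_permL ?block_permR !mxE;
  by case: (split_ordP j) => b ->;
     rewrite !mxE ?eq_lshift ?eq_rshift ?eq_lrshift ?eq_rlshift.
Qed.

Let standardizes (w : 'S_(k + l)) (p : 'S_k * 'S_l) :=
  [forall i, forall j, (p.1 i < p.1 j)%N == (w (lshift l i) < w (lshift l j))%N] &&
  [forall i, forall j, (p.2 i < p.2 j)%N == (w (rshift k i) < w (rshift k j))%N].

Let standardizesP (w : 'S_(k + l)) (p : 'S_k * 'S_l) : reflect
  ((forall i j, (p.1 i < p.1 j)%N = (w (lshift l i) < w (lshift l j))%N) /\
   (forall i j, (p.2 i < p.2 j)%N = (w (rshift k i) < w (rshift k j))%N))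
  (standardizes w p).
Proof.
apply: (iffP andP) => [[/forallP H1 /forallP H2]|[H1 H2]]; split.
- by move=> i j; have /forallP/(_ j)/eqP := H1 i.
- by move=> i j; have /forallP/(_ j)/eqP := H2 i.
- by apply/forallP=> i; apply/forallP=> j; rewrite H1.
- by apply/forallP=> i; apply/forallP=> j; rewrite H2.
Qed.

(** Every [w] is uniquely a block permutation followed by a shuffle: the former records the relative
    order of the values of [w] within each block, and what remains is increasing on both blocks. *)
Lemma sum_perm_shuffle (V : nmodType) (G : 'S_(k + l) -> V) :
  \sum_w G w = \sum_(s | is_shuffle s) \sum_(u : 'S_k) \sum_(t : 'S_l)
                 G (block_perm u t * s)%g.
Proof.
(* The default pair is never reached, since [w] has a standardization on each block. *)
pose std w := odflt (1%g, 1%g) [pick p | standardizes w p].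
have stdE (w : 'S_(k + l)) (p : 'S_k * 'S_l) : (std w == p) = standardizes w p.
  have injL : injective (fun i => nat_of_ord (w (lshift l i))).
    by move=> i j /val_inj/perm_inj/eqP; rewrite eq_lshift => /eqP.
  have injR : injective (fun i => nat_of_ord (w (rshift k i))).
    by move=> i j /val_inj/perm_inj/eqP; rewrite eq_rshift => /eqP.
  have uniq_std q r : standardizes w q -> standardizes w r -> q = r.
    case: q r => [q1 q2] [r1 r2] /standardizesP[/= Q1 Q2] /standardizesP[/= R1 R2].
    by congr (_, _); [apply: standardization_unique Q1 R1 | apply: standardization_unique Q2 R2].
  have [u Hu] := standardization_exists injL; have [t Ht] := standardization_exists injR.
  have Hut : standardizes w (u, t) by apply/standardizesP.
  rewrite /std; case: pickP => [q Hq|/(_ (u, t))]; last by rewrite Hut.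
  by apply/eqP/idP => [<-|/(uniq_std _ _ Hq)].
rewrite (partition_big std xpredT) //= exchange_big /=.
under [RHS]eq_bigr => u _ do rewrite exchange_big /=.
rewrite [RHS]pair_big /=; apply: eq_bigr => -[u t] _ /=.
rewrite (reindex_inj (mulgI (block_perm u t))) /=; apply: eq_bigl => s; rewrite stdE.
apply/standardizesP/andP => /=.
  case=> H1 H2; split; apply/forallP=> i; apply/forallP=> j; apply/implyP=> ltij.
    by have := H1 (u^-1%g i) (u^-1%g j); rewrite !permM !block_permL !permKV => <-.
  by have := H2 (t^-1%g i) (t^-1%g j); rewrite !permM !block_permR !permKV => <-.
case=> /forallP H1 /forallP H2.
have L1 (i j : 'I_k) : (i < j)%N -> (s (lshift l i) < s (lshift l j))%N.
  by move=> ltij; have /forallP/(_ j)/implyP-> := H1 i.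
have L2 (i j : 'I_l) : (i < j)%N -> (s (rshift k i) < s (rshift k j))%N.
  by move=> ltij; have /forallP/(_ j)/implyP-> := H2 i.
split=> i j; rewrite !permM ?block_permL ?block_permR.
  by rewrite (increasing_lt L1).
by rewrite (increasing_lt L2).
Qed.

End BlockPerm.

Lemma mul_rmorph_sum2 (A B : comNzRingType) (f : {rmorphism A -> B}) (I J : finType)
    (a : I -> A) (b : J -> A) (x : B) (c : A) :
  x * f ((\sum_i a i) * (\sum_j b j) * c) = \sum_i \sum_j x * f (a i * b j * c).
Proof.
rewrite mulr_suml mulr_suml rmorph_sum mulr_sumr; apply: eq_bigr => i _.
by rewrite mulr_sumr mulr_suml rmorph_sum mulr_sumr.
Qed.

Section Blocks.
Variables (R : comNzRingType) (k l : nat).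

(** [embL], [embR], [crossN] and [crossD] live over a field; these copies, convertible to them
    there, also serve over the integers. *)
Definition lmp (F : {mpoly R[k]}) : {mpoly R[k + l]} :=
  F \mPo [tuple 'X_(lshift l i) | i < k].
Definition rmp (G : {mpoly R[l]}) : {mpoly R[k + l]} :=
  G \mPo [tuple 'X_(rshift k i) | i < l].
Definition cross1 : {mpoly R[k + l]} :=
  \prod_(i < k) \prod_(j < l) ('X_(lshift l i) - 'X_(rshift k j) + 1).
Definition cross : {mpoly R[k + l]} :=
  \prod_(i < k) \prod_(j < l) ('X_(lshift l i) - 'X_(rshift k j)).

HB.instance Definition _ := GRing.RMorphism.copy lmp
  (comp_mpoly [tuple ('X_(lshift l i) : {mpoly R[k + l]}) | i < k]).
HB.instance Definition _ := GRing.RMorphism.copy rmp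
  (comp_mpoly [tuple ('X_(rshift k i) : {mpoly R[k + l]}) | i < l]).

Lemma lmpX i : lmp 'X_i = 'X_(lshift l i).
Proof. by rewrite /lmp /comp_mpoly mmapX mmap1U tnth_mktuple. Qed.

Lemma rmpX i : rmp 'X_i = 'X_(rshift k i).
Proof. by rewrite /rmp /comp_mpoly mmapX mmap1U tnth_mktuple. Qed.

Lemma mpoly_eq_ind (S : comNzRingType) n (f g : {rmorphism {mpoly R[n]} -> S}) :
  (forall c, f c%:MP = g c%:MP) -> (forall i, f 'X_i = g 'X_i) -> f =1 g.
Proof.
move=> fgC fgX; elim/mpolyind => [|c m p _ _ IHp]; first by rewrite !rmorph0.
rewrite !rmorphD /= IHp -mul_mpolyC !rmorphM /= fgC; congr (_ * _ + _).
by rewrite mpolyXE_id !rmorph_prod; apply: eq_bigr => i _; rewrite !rmorphXn /= fgX.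
Qed.

Lemma msym_block_lmp u t F : msym (block_perm u t) (lmp F) = lmp (msym u F).
Proof.
apply: (mpoly_eq_ind (f := msym (block_perm u t) \o lmp) (g := lmp \o msym u)) => [c|i] /=.
  by rewrite /lmp comp_mpolyC /msym !mmapC comp_mpolyC.
by rewrite lmpX !msymXi lmpX block_permL.
Qed.

Lemma msym_block_rmp u t F : msym (block_perm u t) (rmp F) = rmp (msym t F).
Proof.
apply: (mpoly_eq_ind (f := msym (block_perm u t) \o rmp) (g := rmp \o msym t)) => [c|i] /=.
  by rewrite /rmp comp_mpolyC /msym !mmapC comp_mpolyC.
by rewrite rmpX !msymXi rmpX block_permR.
Qed.

Lemma msym_block_cross1 u t : msym (block_perm u t) cross1 = cross1.
Proof.
rewrite rmorph_prod [RHS](reindex_inj (@perm_inj _ u)); apply: eq_bigr => i _ /=.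
rewrite rmorph_prod [RHS](reindex_inj (@perm_inj _ t)); apply: eq_bigr => j _ /=.
by rewrite rmorphD rmorphB rmorph1 /= !msymXi block_permL block_permR.
Qed.

(** Block permutations fix [cross1], act separately on the two factors and have multiplicative sign,
    so the inner sums of [sum_perm_shuffle] become [alt g] and [alt h]. *)
Lemma alt_shuffle (g : {mpoly R[k]}) (h : {mpoly R[l]}) :
  alt (lmp g * rmp h * cross1) =
  \sum_(s : 'S_(k + l) | is_shuffle s)
    (-1) ^+ s * msym s (lmp (alt g) * rmp (alt h) * cross1).
Proof.
rewrite [in LHS]/alt [LHS]sum_perm_shuffle; apply: eq_bigr => s _.
rewrite [alt g]/alt [alt h]/alt (raddf_sum lmp) (raddf_sum rmp) /=.
rewrite [RHS]mul_rmorph_sum2; apply: eq_bigr => u _; apply: eq_bigr => t _ /=.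
rewrite odd_permM signr_addb block_perm_sign msymMm.
rewrite (rmorphM (msym (block_perm u t))) /= (rmorphM (msym (block_perm u t))) /=.
rewrite msym_block_lmp msym_block_rmp msym_block_cross1.
rewrite (rmorphM lmp) (rmorphM rmp) /= !(rmorph_sign lmp, rmorph_sign rmp).
rewrite !(rmorphM (msym s)) /= !(rmorph_sign (msym s)).
by move: (_ ^+ u) (_ ^+ t) (_ ^+ s) (msym s _) (msym s _) (msym s _) => a b c d e f; ring.
Qed.

Lemma big_lshift_lt (i : 'I_k) (f : 'I_(k + l) -> {mpoly R[k + l]}) :
  \prod_(j < k + l | (lshift l i < j)%N) f j =
  (\prod_(j < k | (i < j)%N) f (lshift l j)) * \prod_(j < l) f (rshift k j).
Proof.
rewrite big_mkcond big_split_ord /= -big_mkcond /=; congr (_ * _).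
by apply: eq_bigr => j _; rewrite ltn_addr.
Qed.

Lemma big_rshift_lt (i : 'I_l) (f : 'I_(k + l) -> {mpoly R[k + l]}) :
  \prod_(j < k + l | (rshift k i < j)%N) f j = \prod_(j < l | (i < j)%N) f (rshift k j).
Proof.
rewrite big_mkcond big_split_ord /= big1 ?mul1r => [|j _]; last first.
  by rewrite ltnNge (leq_trans (ltnW (ltn_ord j))) ?leq_addr.
by rewrite [RHS]big_mkcond; apply: eq_bigr => j _; rewrite ltn_add2l.
Qed.

Lemma vdm_block : vdm R (k + l) = lmp (vdm R k) * rmp (vdm R l) * cross.
Proof.
rewrite /vdm big_split_ord /=; under eq_bigr do rewrite big_lshift_lt.
under [X in _ * X]eq_bigr do rewrite big_rshift_lt.
rewrite big_split /= mulrAC !rmorph_prod; congr (_ * _ * _); apply: eq_bigr => i _;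
  by rewrite rmorph_prod; apply: eq_bigr => j _; rewrite rmorphB /= ?lmpX ?rmpX.
Qed.

Lemma vdm1_block : vdm1 R (k + l) = lmp (vdm1 R k) * rmp (vdm1 R l) * cross1.
Proof.
rewrite /vdm1 big_split_ord /=; under eq_bigr do rewrite big_lshift_lt.
under [X in _ * X]eq_bigr do rewrite big_rshift_lt.
rewrite big_split /= mulrAC !rmorph_prod; congr (_ * _ * _); apply: eq_bigr => i _;
  by rewrite rmorph_prod; apply: eq_bigr => j _;
     rewrite rmorphD rmorphB rmorph1 /= ?lmpX ?rmpX.
Qed.

(** By [vdm1_block], the block factors of [vdm1] are absorbed into the two arguments of
    [alt_shuffle]. *)
Lemma alt_block (g : {mpoly R[k]}) (h : {mpoly R[l]}) :
  alt (lmp g * rmp h * vdm1 R (k + l)) =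
  \sum_(s : 'S_(k + l) | is_shuffle s)
    (-1) ^+ s * msym s (lmp (alt (g * vdm1 R k)) * rmp (alt (h * vdm1 R l)) * cross1).
Proof.
by rewrite -alt_shuffle vdm1_block !rmorphM /= -!mulrA; congr (alt (_ * _)); rewrite mulrCA.
Qed.

End Blocks.

(** * The shuffle product without denominators *)

Lemma vdm_neq0 (R : idomainType) n : vdm R n != 0.
Proof.
apply/prodf_neq0 => i _; apply/prodf_neq0 => j ltij; apply/eqP => /(congr1 (mcoeff U_(i))).
rewrite mcoeffB !mcoeffXU mcoeff0 eqxx -val_eqE eq_sym (ltn_eqF ltij) subr0.
by move/eqP; rewrite oner_eq0.
Qed.

Lemma msym_neq0 (R : idomainType) n (s : 'S_n) (f : {mpoly R[n]}) : f != 0 -> msym s f != 0.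
Proof. by rewrite -[X in _ -> _ != X](msym0 R s) (inj_eq (inj_msym s)). Qed.

Lemma vdm_sign (R : comNzRingType) n (s : 'S_n) : vdm R n = (-1) ^+ s * msym s (vdm R n).
Proof. by rewrite msym_vdm mulrA -expr2 sqrr_sign mul1r. Qed.

(** Each denominator is [vdm] up to sign, so [vdm] clears all of them at once. *)
Lemma sum_frac_vdm (R : idomainType) n (g : {mpoly R[n]}) :
  (\sum_(s : 'S_n) tofrac (msym s g) / tofrac (msym s (vdm R n))) * tofrac (vdm R n) =
  tofrac (alt g).
Proof.
rewrite mulr_suml [RHS]rmorph_sum; apply: eq_bigr => s _ /=.
rewrite {2}(vdm_sign _ s) !tofracM mulrC -mulrA; congr (_ * _).
by rewrite mulrCA divff ?mulr1 // tofrac_eq0 msym_neq0 // vdm_neq0.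
Qed.

Definition xmon (R : comNzRingType) n (lam : seq nat) : {mpoly R[n]} :=
  \prod_(i < n) 'X_i ^+ nth 0%N lam i.

Lemma is_PZ_alt n lam (H : {mpoly int[n]}) :
  is_PZ lam H <-> (mulp lam)%:R * H * vdm int n = alt (xmon int n lam * vdm1 int n).
Proof.
have nz : tofrac (vdm int n) != 0 by rewrite tofrac_eq0 vdm_neq0.
rewrite /is_PZ; split=> [E|E].
  by apply/eqP; rewrite -tofrac_eq tofracM E; apply/eqP/sum_frac_vdm.
apply: (mulIf nz); rewrite -tofracM E; symmetry; exact: sum_frac_vdm.
Qed.

Lemma frac_term_identity (L : fieldType) (a b c d e x y : L) : d != 0 ->
  a * b * c / d * (e * (x * y * d)) = e * (a * x * (b * y) * c).
Proof. by move=> nz; field. Qed.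

Section Star.
Variables (K : fieldType) (k l : nat).

(** In each summand [vdm] is rewritten as a signed permuted copy of itself. Its cross factor cancels
    the denominator, and its block factors turn [F] and [G] into the alternations of [alt_block]. *)
Lemma star_frac_vdm (F f : {mpoly K[k]}) (G g : {mpoly K[l]}) :
  F * vdm K k = alt (f * vdm1 K k) -> G * vdm K l = alt (g * vdm1 K l) ->
  star_frac F G * tofrac (vdm K (k + l)) = tofrac (alt (lmp l f * rmp k g * vdm1 K (k + l))).
Proof.
move=> EF EG; rewrite alt_block -EF -EG /star_frac mulr_suml [RHS]rmorph_sum.
apply: eq_bigr => s _ /=.
have nz : tofrac (msym s (crossD K k l)) != 0.
  rewrite tofrac_eq0 msym_neq0 //; have := vdm_neq0 K (k + l).
  by rewrite vdm_block mulf_eq0 negb_or => /andP[].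
rewrite -[embL l F]/(lmp l F) -[embR k G]/(rmp k G) -[crossN K k l]/(cross1 K k l).
rewrite {1}(vdm_sign K s) vdm_block -[cross K k l]/(crossD K k l).
rewrite (rmorphM (@lmp K k l)) (rmorphM (@rmp K k l)) /=.
rewrite !msymM !tofracM; exact: frac_term_identity.
Qed.

Lemma is_star_alt (F f : {mpoly K[k]}) (G g : {mpoly K[l]}) H :
  F * vdm K k = alt (f * vdm1 K k) -> G * vdm K l = alt (g * vdm1 K l) ->
  is_star F G H <-> H * vdm K (k + l) = alt (lmp l f * rmp k g * vdm1 K (k + l)).
Proof.
move=> EF EG; have E := star_frac_vdm EF EG.
have nz : tofrac (vdm K (k + l)) != 0 by rewrite tofrac_eq0 vdm_neq0.
rewrite /is_star; split=> EH.
  by apply/eqP; rewrite -tofrac_eq tofracM EH E.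
by apply: (mulIf nz); rewrite -tofracM EH E.
Qed.
End Star.

(** * Leading terms and integrality *)

Section Degree.

(** [msize] is the degree plus one, and 0 for the zero polynomial, so the bound says that the degree
    is below [d]. *)
Lemma msize_leP (R : nzRingType) n (f : {mpoly R[n]}) d :
  (msize f <= d)%N <-> (forall m : 'X_{1..n}, (d <= mdeg m)%N -> f@_m = 0).
Proof.
split=> [le m led|H].
  by apply/eqP; rewrite mcoeff_eq0 msize_mdeg_ge // (leq_trans le).
rewrite msizeE; apply/bigmax_leqP_seq => m; rewrite mcoeff_msupp => + _.
by apply: contraR; rewrite -leqNgt => /H->.
Qed.

Lemma msize_sum_le (R : nzRingType) n (I : finType) (F : I -> {mpoly R[n]}) d :
  (forall i, (msize (F i) <= d)%N) -> (msize (\sum_i F i) <= d)%N.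
Proof.
move=> H; apply/msize_leP => m led; rewrite linear_sum big1 // => i _.
exact: (proj1 (msize_leP _ _) (H i)).
Qed.

Lemma msize_msym (R : nzRingType) n (s : 'S_n) (f : {mpoly R[n]}) :
  (msize (msym s f) <= msize f)%N.
Proof.
apply/msize_leP => m; rewrite mcoeff_sym => led.
by apply: (proj1 (msize_leP f (msize f))); rewrite ?mdeg_mperm.
Qed.

Lemma msize_alt (R : comNzRingType) n (f : {mpoly R[n]}) : (msize (alt f) <= msize f)%N.
Proof.
apply: msize_sum_le => s; rewrite -signr_odd; case: (odd _).
  by rewrite mulN1r msizeN msize_msym.
by rewrite mul1r msize_msym.
Qed.

Variable R : idomainType.

(** Each factor is nonconstant, so adding 1 to it leaves the top-degree part of the product
    unchanged. *)
Lemma msize_prod_add1 n (I : Type) (r : seq I) (P : pred I) (F : I -> {mpoly R[n]}) :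
  (forall i, P i -> (1 < msize (F i))%N) ->
  (msize (\prod_(i <- r | P i) (F i + 1) - \prod_(i <- r | P i) F i)
    < msize (\prod_(i <- r | P i) F i))%N.
Proof.
(* Nonvanishing is carried through the induction because degrees add up only for nonzero factors. *)
move=> gt1; suff [] : \prod_(i <- r | P i) F i != 0 /\
  (msize (\prod_(i <- r | P i) (F i + 1) - \prod_(i <- r | P i) F i)
    < msize (\prod_(i <- r | P i) F i))%N by [].
elim: r => [|a r [nz IHr]]; first by rewrite !big_nil subrr msize0 msize1 oner_neq0.
rewrite !big_cons; case: ifP => // /gt1 Fa.
move: (\prod_(i <- r | P i) F i) (\prod_(i <- r | P i) (F i + 1)) (F a) Fa nz IHr => A B f.
move=> f_gt1 nzA ltB; have nzf : f != 0 by rewrite -msize_poly_eq0 -lt0n ltnW.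
split; first by rewrite mulf_neq0.
have -> : (f + 1) * B - f * A = f * (B - A) + (B - A) + A by ring.
rewrite msizeM //; have ltA : (msize A < (msize f + msize A).-1)%N.
  by move: f_gt1; case: (msize f) => [|[|c]] //= _; rewrite ltnS leq_addl.
have ltAB : (msize (B - A) < (msize f + msize A).-1)%N by apply: ltn_trans ltA.
apply: leq_ltn_trans (msizeD_le _ _) _; rewrite gtn_max ltA andbT.
apply: leq_ltn_trans (msizeD_le _ _) _; rewrite gtn_max ltAB andbT.
have [->|nzBA] := eqVneq (B - A) 0; first by rewrite mulr0 msize0 (leq_ltn_trans _ ltA).
rewrite msizeM //; move: f_gt1 ltB; case: (msize f) => // c _.
by rewrite !addSn /= ltn_add2l.
Qed.

Lemma msize_vdm1_sub n : (msize (vdm1 R n - vdm R n) < msize (vdm R n))%N.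
Proof.
rewrite /vdm1 /vdm !pair_big_dep /=; apply: msize_prod_add1 => -[i j] /= ltij.
rewrite ltnNge; apply/negP => /msize_leP/(_ U_(i))%MM.
rewrite mdeg1 mcoeffB !mcoeffXU eqxx -val_eqE eq_sym (ltn_eqF ltij) subr0 => /(_ isT)/eqP.
by rewrite oner_eq0.
Qed.

(** With [vdm] in place of [vdm1], [alt_vdmM] gives exactly [vdm] times the symmetrization of [g].
    The error made has lower degree, and still does after division by [vdm]. *)
Lemma alt_vdm1_lead n (g c : {mpoly R[n]}) : g != 0 -> alt (g * vdm1 R n) = c * vdm R n ->
  (msize (c - \sum_(s : 'S_n) msym s g) < msize g)%N.
Proof.
move=> nzg E.
have : (c - \sum_(s : 'S_n) msym s g) * vdm R n = alt (g * (vdm1 R n - vdm R n)).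
  by rewrite mulrBl -E mulrBr raddfB /= [g * vdm _ _]mulrC alt_vdmM [vdm _ _ * _]mulrC.
move: (c - _) => {E} {}c E.
have [->|nzc] := eqVneq c 0; first by rewrite msize0 lt0n msize_poly_eq0.
have := msize_alt (g * (vdm1 R n - vdm R n)); rewrite -E msizeM // ?vdm_neq0 //.
have [->|nzv] := eqVneq (vdm1 R n - vdm R n) 0.
  rewrite mulr0 msize0 leqn0; have := vdm_neq0 R n; rewrite -msize_poly_eq0 -lt0n.
  have: (0 < msize c)%N by rewrite lt0n msize_poly_eq0.
  by case: (msize c) => // x _; case: (msize _) => // y _; rewrite addSn addnS.
rewrite msizeM //; have := msize_vdm1_sub n; have := nzv; rewrite -msize_poly_eq0 -lt0n.
move: nzc nzg; rewrite -!msize_poly_eq0 -!lt0n.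
case: (msize c) => // x _; case: (msize g) => // y _; case: (msize (_ - _)) => // z _.
case: (msize _) => // t; rewrite !addSn /= ltnS !addnS => ltzt.
by rewrite !ltnS => le_xy; rewrite -(ltn_add2r t) (leq_ltn_trans le_xy) ?ltn_add2l.
Qed.

(** For [g = 1] the error in [alt_vdm1_lead] has size 0, so the quotient is the sum of [n!] ones. *)
Lemma alt_vdm1 n : alt (vdm1 R n) = (n`!)%:R * vdm R n.
Proof.
have [c Ec] := alt_dvd_vdm (vdm1 R n).
have := @alt_vdm1_lead n 1 c (oner_neq0 _); rewrite mul1r => /(_ Ec).
under eq_bigr do rewrite msym1.
rewrite sumr_const -[#|_|]/#|'S_n| card_Sn msize1 ltnS leqn0 msize_poly_eq0 subr_eq0.
by move=> /eqP <-.
Qed.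

End Degree.

(** * Regularity of the Vandermonde product and change of coefficients *)

Section Torsion.

Lemma coef_XsubX (R : comNzRingType) n (i j : 'I_n) (m : 'X_{1..n}) :
  ('X_i - 'X_j : {mpoly R[n]})@_m = (U_(i) == m)%MM%:R - (U_(j) == m)%MM%:R.
Proof. by rewrite mcoeffB !mcoeffX. Qed.

(** The leading coefficient is 1 or -1, hence regular even in a ring with zero divisors. *)
Lemma XsubX_lreg (R : comNzRingType) n (i j : 'I_n) :
  i != j -> GRing.lreg ('X_i - 'X_j : {mpoly R[n]}).
Proof.
move=> neq; apply: lreg_mleadc.
have nz : 'X_i - 'X_j != 0 :> {mpoly R[n]}.
  apply/eqP => /(congr1 (mcoeff U_(i))); rewrite mcoeffB !mcoeffXU mcoeff0 eqxx eq_sym.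
  by rewrite (negPf neq) subr0; move/eqP; rewrite oner_eq0.
have := nz; rewrite -mleadc_eq0 coef_XsubX.
case: (_ == mlead _); case: (_ == mlead _); rewrite ?(subrr, subr0, sub0r, eqxx) // => _.
  exact: lreg1.
exact/lregN/lreg1.
Qed.

Lemma vdm_lreg (R : comNzRingType) n : GRing.lreg (vdm R n).
Proof.
rewrite /vdm; elim/big_rec: _ => [|i f _ regf]; first exact: lreg1.
apply: lregM regf; elim/big_rec: _ => [|j g ltij regg]; first exact: lreg1.
by apply: lregM regg; apply: XsubX_lreg; rewrite -val_eqE (ltn_eqF ltij).
Qed.

Variables (R S : comNzRingType) (f : {rmorphism R -> S}) (n : nat).

Lemma map_mpolyXi i : map_mpoly f ('X_i : {mpoly R[n]}) = 'X_i.
Proof. exact: map_mpolyX. Qed.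

Lemma map_vdm : map_mpoly f (vdm R n) = vdm S n.
Proof.
rewrite rmorph_prod; apply: eq_bigr => i _; rewrite rmorph_prod; apply: eq_bigr => j _.
by rewrite rmorphB /= !map_mpolyXi.
Qed.

Lemma map_vdm1 : map_mpoly f (vdm1 R n) = vdm1 S n.
Proof.
rewrite rmorph_prod; apply: eq_bigr => i _; rewrite rmorph_prod; apply: eq_bigr => j _.
by rewrite rmorphD rmorphB rmorph1 /= !map_mpolyXi.
Qed.

Lemma map_xmon lam : map_mpoly f (xmon R n lam) = xmon S n lam.
Proof.
by rewrite rmorph_prod; apply: eq_bigr => i _; rewrite rmorphXn /= map_mpolyXi.
Qed.

Lemma map_msym (s : 'S_n) (g : {mpoly R[n]}) : map_mpoly f (msym s g) = msym s (map_mpoly f g).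
Proof. by apply/mpolyP=> m; rewrite mcoeff_map_mpoly !mcoeff_sym mcoeff_map_mpoly. Qed.

Lemma map_alt (g : {mpoly R[n]}) : map_mpoly f (alt g) = alt (map_mpoly f g).
Proof.
rewrite rmorph_sum; apply: eq_bigr => s _.
by rewrite (rmorphM (map_mpoly f)) /= (rmorph_sign (map_mpoly f)) map_msym.
Qed.

End Torsion.

Lemma intr_Zp_eq0 c (z : int) : (1 < c)%N -> (z%:~R == 0 :> 'Z_c) = (c %| `|z|)%N.
Proof.
move=> c_gt1; have natE (m : nat) : (m%:R == 0 :> 'Z_c) = (c %| m)%N.
  by rewrite -val_eqE /= val_Zp_nat.
by case: z => m; rewrite ?NegzE ?mulrNz ?oppr_eq0 /= -?pmulrn natE // abszN.
Qed.

(* [vdm] is regular over any ring, in particular over Z/c. *)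
Lemma vdm_dvd_int n c (B Z : {mpoly int[n]}) : (0 < c)%N ->
  B * vdm int n = c%:R * Z -> exists B', B = c%:R * B'.
Proof.
(* ['Z_1] is encoded as Z/2, so the case [c = 1] is split off. *)
case: c => [|[|c]] // _ E; first by exists B; rewrite mul1r.
pose f : {rmorphism int -> 'Z_c.+2} := intmul 1.
have /(congr1 (map_mpoly f)) := E; rewrite !rmorphM /= map_vdm rmorph_nat.
have -> : c.+2%:R = 0 :> {mpoly 'Z_c.+2[n]} by rewrite -mpolyC_nat pchar_Zp // mpolyC0.
rewrite mul0r mulrC -[RHS](mulr0 (vdm 'Z_c.+2 n)) => /vdm_lreg Bf0.
(* The division of each coefficient is exact, because [B] reduces to 0 in ['Z_c.+2]. *)
exists (\sum_(m <- msupp B) ((B@_m %/ c.+2)%Z *: 'X_[m])).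
rewrite {1}[B]mpolyE mulr_sumr; apply: eq_bigr => m _.
rewrite -mpolyC_nat mul_mpolyC scalerA; congr (_ *: _); rewrite natz mulrC divzK //.
rewrite dvdzE /= -intr_Zp_eq0 //.
by rewrite -[_%:~R](mcoeff_map_mpoly f) Bf0 mcoeff0.
Qed.

Lemma sorted_geq_nseq a (s : seq nat) : sorted geq (a :: s) ->
  exists m t, [/\ a :: s = nseq m.+1 a ++ t, a \notin t & sorted geq t].
Proof.
elim: s => [|b s IHs] in a *; first by exists 0%N, [::].
rewrite [sorted _ _]/=; case/andP=> leba path_bs.
have [eqab|neq] := eqVneq a b.
  have [m [t [E at' st]]] := IHs b path_bs.
  by exists m.+1, t; rewrite -eqab in E at' *; rewrite E.
exists 0%N, (b :: s); split=> //; rewrite inE negb_or neq /=.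
apply/negP => /(allP (order_path_min (rev_trans leq_trans) path_bs)) /= leab.
by move: leba neq; rewrite /= eqn_leq leab => ->.
Qed.

Lemma mulp_nseq_cat m a t : a \notin t ->
  mulp (nseq m.+1 a ++ t) = ((if a != 0 then (m.+1)`! else 1) * mulp t)%N.
Proof.
move=> nat_; rewrite /mulp.
have -> : undup (nseq m.+1 a ++ t) = a :: undup t.
  elim: m => [|m IHm]; first by rewrite /= (negPf nat_).
  by rewrite [LHS]/= inE eqxx; exact: IHm.
rewrite big_cons count_cat count_nseq [pred1 a a]/= eqxx mul1n (count_memPn nat_) addn0.
have -> : (\prod_(i <- undup t | i != 0) (count_mem i (nseq m.+1 a ++ t))`! =
           \prod_(i <- undup t | i != 0) (count_mem i t)`!)%N.
  rewrite big_seq_cond [RHS]big_seq_cond; apply: eq_bigr => i /andP[].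
  rewrite mem_undup => it _; rewrite count_cat count_nseq /=.
  by have [E|_] := eqVneq a i; [rewrite -E (negPf nat_) in it | rewrite mul0n].
by case: eqP; rewrite ?mul1n.
Qed.

Lemma mulp_gt0 lam : (0 < mulp lam)%N.
Proof. by apply: prodn_cond_gt0 => i _; apply: fact_gt0. Qed.

Lemma xmon_cat (R : comNzRingType) m l (s t : seq nat) : size s = m ->
  xmon R (m + l) (s ++ t) = lmp l (xmon R m s) * rmp m (xmon R l t).
Proof.
move=> ss; rewrite /xmon big_split_ord /= (rmorph_prod (@lmp R m l)) (rmorph_prod (@rmp R m l)).
congr (_ * _); apply: eq_bigr => i _; rewrite rmorphXn /= ?lmpX ?rmpX nth_cat ss ?ltn_ord //.
by rewrite ltnNge leq_addr /= addKn.
Qed.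

Lemma msym_xmon_nseq (R : comNzRingType) m a (s : 'S_m) :
  msym s (xmon R m (nseq m a)) = xmon R m (nseq m a).
Proof.
rewrite rmorph_prod [RHS](reindex_inj (@perm_inj _ s)); apply: eq_bigr => i _ /=.
by rewrite rmorphXn /= msymXi !nth_nseq !ltn_ord.
Qed.

Lemma alt_xmon_nseq (R : idomainType) m a :
  alt (xmon R m (nseq m a) * vdm1 R m) = (m`!)%:R * (xmon R m (nseq m a) * vdm R m).
Proof.
transitivity (xmon R m (nseq m a) * alt (vdm1 R m)); last by rewrite alt_vdm1 mulrCA.
rewrite /alt mulr_sumr; apply: eq_bigr => s _.
by rewrite msymM msym_xmon_nseq mulrCA.
Qed.

(* Splitting off the m copies of the largest part turns alternation into a sum over
   shuffles, in which that block contributes m! because alt vdm1 = m! vdm. *)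
Lemma alt_xmon_dvd n lam : size lam = n -> sorted geq lam ->
  exists Z, alt (xmon int n lam * vdm1 int n) = (mulp lam)%:R * Z.
Proof.
have [N] := ubnP (size lam); elim: N => // N IHN in n lam *.
case: lam => [_ _ _|a lam].
  by rewrite /mulp big_nil; exists (alt (xmon int n [::] * vdm1 int n)); rewrite mul1r.
move=> ltN En /sorted_geq_nseq[m [t [E nat_ st]]].
rewrite E; have {}En : n = (m.+1 + size t)%N by rewrite -En E size_cat size_nseq.
subst n; have [|Z EZ] := IHN (size t) t _ erefl st.
  by move: ltN; rewrite E size_cat size_nseq ltnS => /(leq_trans _); apply; rewrite addSn ltnS leq_addl.
rewrite mulp_nseq_cat // xmon_cat ?size_nseq // alt_block alt_xmon_nseq EZ.
pose A := xmon int m.+1 (nseq m.+1 a) * vdm int m.+1.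
(* [mulp] skips the part 0, so for [a = 0] the factorial of the block goes into the quotient
   instead. *)
exists ((if a != 0%N then 1 else (m.+1)`!)%:R *
  \sum_(s : 'S_(m.+1 + size t) | is_shuffle s)
    (-1) ^+ s * msym s (lmp (size t) A * rmp m.+1 Z * cross1 int m.+1 (size t))).
rewrite [RHS]mulrA -natrM [RHS]mulr_sumr; apply: eq_bigr => s _.
rewrite -/A (rmorphM (@lmp int m.+1 (size t))) (rmorphM (@rmp int m.+1 (size t))) /= !rmorph_nat.
rewrite mulrACA -natrM -!mulrA [in LHS]msymM rmorph_nat mulrCA.
by congr (_%:R * _); case: ifP; rewrite ?mul1n ?muln1 // mulnC.
Qed.

(** The alternation is a multiple of [vdm] and of [mulp lam]; by [vdm_dvd_int] its quotient by [vdm]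
    is still a multiple of [mulp lam]. *)
Lemma is_PZ_exists n lam : is_partition n lam -> exists H : {mpoly int[n]}, is_PZ lam H.
Proof.
case/andP=> /eqP sz srt; have [Z EZ] := alt_xmon_dvd sz srt.
have [c Ec] := alt_dvd_vdm (xmon int n lam * vdm1 int n).
have [H EH] := vdm_dvd_int (mulp_gt0 lam) (etrans (esym Ec) EZ).
by exists H; apply/is_PZ_alt; rewrite Ec EH.
Qed.

(** * The image satisfies the wheel condition *)

Section Image.
Variable K : fieldType.

Lemma alt_xmon0 : 1 * vdm K 0 = alt (1 * vdm1 K 0).
Proof. by rewrite !mul1r alt_vdm1 mul1r. Qed.

Lemma alt_xmon1 a :
  'X_ord0 ^+ a * vdm K 1 = alt ('X_ord0 ^+ a * vdm1 K 1).
Proof.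
have E : xmon K 1 (nseq 1 a) = 'X_ord0 ^+ a by rewrite /xmon big_ord_recl big_ord0 mulr1.
by rewrite -E alt_xmon_nseq mul1r.
Qed.

(** [F] is the product of the generators e_a for [a] in [lam], built by multiplying on the left by
    one generator at a time. *)
Lemma imPsi_xmon lam : exists F : {mpoly K[size lam]},
  imPsi F /\ F * vdm K (size lam) = alt (xmon K (size lam) lam * vdm1 K (size lam)).
Proof.
elim: lam => [|a lam [G [imG EG]]].
  exists 1; split; first by move=> S [[]].
  by rewrite /xmon big_ord0 alt_xmon0.
have [H EH] := alt_dvd_vdm (xmon K (1 + size lam) ([:: a] ++ lam) * vdm1 K (1 + size lam)).
exists H; split; last exact: esym EH.
rewrite xmon_cat // {1}/xmon big_ord_recl big_ord0 mulr1 /= in EH.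
move=> S clS; have [[_ SX _] [_ _ Sstar]] := clS.
apply: (Sstar 1%N (size lam) ('X_ord0 ^+ a) G) => //; first exact: imG.
by apply/(is_star_alt _ (alt_xmon1 a) EG); rewrite EH.
Qed.

(** The property holds for the generators and is stable under all operations; [is_star_alt] handles
    the products. *)
Lemma imPsi_ex_alt n (f : {mpoly K[n]}) : imPsi f -> exists g, f * vdm K n = alt (g * vdm1 K n).
Proof.
move=> /(_ (fun n (f : {mpoly K[n]}) => exists g, f * vdm K n = alt (g * vdm1 K n))).
apply.
split; split.
- by exists 1; apply: alt_xmon0.
- by move=> r; exists ('X_ord0 ^+ r); apply: alt_xmon1.
- by move=> m; exists 0; rewrite !mul0r raddf0.
- by move=> m f1 f2 [g1 E1] [g2 E2]; exists (g1 + g2); rewrite !mulrDl E1 E2 raddfD.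
- by move=> m c f1 [g1 E1]; exists (c *: g1); rewrite -!scalerAl E1 altZ.
move=> k l F G H [f1 EF] [g1 EG] /(is_star_alt _ EF EG) EH.
by exists (lmp l f1 * rmp k g1).
Qed.

(** [vdm] and the alternation change by the same sign, so their quotient is invariant. *)
Lemma imPsi_symmetric n (f : {mpoly K[n]}) : imPsi f -> f \is symmetric.
Proof.
case/imPsi_ex_alt => g Eg; apply/issymP => s; apply: (mulIf (vdm_neq0 K n)).
rewrite {1}(vdm_sign K s) mulrCA -msymM Eg msym_alt mulrA -expr2 sqrr_sign mul1r.
by rewrite -Eg.
Qed.

Variable p : nat.
Hypothesis hchar : p \in [pchar K].

Lemma pcharf_natr_neq0 m : (0 < m < p)%N -> m%:R != 0 :> K.
Proof.
by case/andP=> m0 mp; rewrite -(dvdn_pcharf hchar); apply/negP => /(dvdn_leq m0); rewrite leqNgt mp.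
Qed.

Lemma pcharf_fact_neq0 m : (m < p)%N -> (m`!)%:R != 0 :> K.
Proof.
elim: m => [|m IHm] ltmp; first exact: oner_neq0.
by rewrite factS natrM mulf_neq0 ?IHm ?pcharf_natr_neq0 // ltnW.
Qed.

Lemma mulp_neq0 lam : p_restricted p lam -> (mulp lam)%:R != 0 :> K.
Proof.
move=> /allP restr; rewrite natr_prod prodf_seq_neq0; apply/allP => i.
by rewrite mem_undup => /restr lti; apply/implyP => _; apply: pcharf_fact_neq0.
Qed.

(* Generic point of the wheel locus [x_1 = x_2 + 1 = ... = x_p + p - 1]. *)
Definition wheel n : n.+1.-tuple {mpoly K[n.+1]} :=
  [tuple if (i < p)%N then 'X_ord0 - i%:R else 'X_i | i < n.+1].

Lemma wheelX n i : 'X_i \mPo wheel n = if (i < p)%N then 'X_ord0 - i%:R else 'X_i.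
Proof. by rewrite /comp_mpoly mmapX mmap1U tnth_mktuple. Qed.

(** Two of the first [p] coordinates differ by an integer strictly between 0 and [p], nonzero in
    [K]; every other difference involves a variable of index at least [p]. *)
Lemma wheel_vdm n : vdm K n.+1 \mPo wheel n != 0.
Proof.
rewrite /vdm rmorph_prod; apply/prodf_neq0 => i _; rewrite rmorph_prod.
apply/prodf_neq0 => j ltij; rewrite rmorphB /= !wheelX; case: (ltnP j p) => [ltjp|lepj].
  rewrite (ltn_trans ltij ltjp) opprB addrC addrA addrNK -natrB ?(ltnW ltij) //.
  rewrite -mpolyC_nat mpolyC_eq0 pcharf_natr_neq0 //.
  by rewrite subn_gt0 ltij (leq_ltn_trans (leq_subr _ _)).
have p0 : (0 < p)%N by rewrite (prime_gt0 (pcharf_prime hchar)).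
apply/eqP => /(congr1 (mcoeff U_(j))); rewrite mcoeff0 mcoeffB mcoeffXU eqxx.
have -> : (if (i < p)%N then 'X_ord0 - i%:R else 'X_i : {mpoly K[n.+1]})@_U_(j) = 0.
  case: ifP => _; last by rewrite mcoeffXU -val_eqE (ltn_eqF ltij).
  rewrite mcoeffB mcoeffXU -mpolyC_nat mcoeffC -val_eqE /= (ltn_eqF (leq_trans p0 lepj)).
  by rewrite mnm1_eq0 mulr0 subr0.
by move/eqP; rewrite sub0r oppr_eq0 oner_eq0.
Qed.

(** Among the indices below [p], let [a] have the smallest preimage under [s], and let [b] be its
    cyclic predecessor. The permuted [vdm1] then has the factor ['X_a - 'X_b + 1], which is 0 at the
    generic wheel point. *)
Lemma wheel_vdm1 n (s : 'S_n.+1) : (p <= n.+1)%N -> msym s (vdm1 K n.+1) \mPo wheel n = 0.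
Proof.
move=> lepn; have p_gt1 := prime_gt1 (pcharf_prime hchar); have p_gt0 := ltnW p_gt1.
pose t := s^-1%g; pose a := [arg min_(i < ord0 : 'I_n.+1 | (i < p)%N) t i].
have [ltap mina] : (a < p)%N /\ forall b : 'I_n.+1, (b < p)%N -> (t a <= t b)%N.
  by rewrite /a; case: arg_minnP.
(* For [a = 0] the predecessor wraps around to [p - 1]; this works because [p] is 0 in [K]. *)
pose b : 'I_n.+1 := inord (if (a : nat) == 0%N then p.-1 else a.-1).
have Eb : b = (if (a : nat) == 0%N then p.-1 else a.-1) :> nat.
  rewrite inordK //; case: ifP => _; first by rewrite prednK.
  exact: leq_ltn_trans (leq_pred _) _.
have ltbp : (b < p)%N.
  by rewrite Eb; case: ifP => _; [rewrite prednK | apply: leq_ltn_trans (leq_pred _) _].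
have neab : a != b.
  rewrite -val_eqE /= Eb; case: (nat_of_ord a) => [|c] /=; last by rewrite eqn_leq ltnn.
  by rewrite eq_sym -lt0n -subn1 subn_gt0.
have lttab : (t a < t b)%N.
  by rewrite ltn_neqAle mina // andbT; apply: contraNneq neab => /val_inj/perm_inj->.
rewrite /vdm1 (bigD1 (t a)) //= (bigD1 (t b)) //= !msymM rmorphD rmorphB rmorph1 /= !msymXi.
rewrite !permKV !rmorphM /= rmorphD rmorphB rmorph1 /= !wheelX ltap ltbp.
suff -> : 'X_ord0 - a%:R - ('X_ord0 - b%:R) + 1 = 0 :> {mpoly K[n.+1]} by rewrite !mul0r.
have -> : 'X_ord0 - a%:R - ('X_ord0 - b%:R) + 1 = b.+1%:R - a%:R :> {mpoly K[n.+1]}.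
  by rewrite -natr1; ring.
rewrite Eb; case: (nat_of_ord a) => [|c] /=; last by rewrite subrr.
by rewrite prednK // subr0 -mpolyC_nat (pcharf0 hchar) mpolyC0.
Qed.

Lemma imPsi_wheel n (f : {mpoly K[n.+1]}) : (p <= n.+1)%N -> imPsi f -> f \mPo wheel n = 0.
Proof.
move=> lepn /imPsi_ex_alt[g /(congr1 (comp_mpoly (wheel n)))].
rewrite rmorphM /= rmorph_sum /= big1 => [/eqP|s _]; last first.
  by rewrite msymM !rmorphM /= wheel_vdm1 // !mulr0.
by rewrite mulf_eq0 (negPf (wheel_vdm n)) orbF => /eqP.
Qed.

(** The wheel substitution fixes every point of the wheel locus. *)
Lemma meval_wheel n (f : {mpoly K[n.+1]}) (v : 'I_n.+1 -> K) :
  (forall i j : 'I_n.+1, (i < p)%N -> (j < p)%N -> v i + i%:R = v j + j%:R) ->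
  f.@[v] = (f \mPo wheel n).@[v].
Proof.
move=> Ev; have p_gt0 := prime_gt0 (pcharf_prime hchar).
rewrite comp_mpoly_meval; apply: meval_eq => i; rewrite tnth_mktuple.
case: ifP => lti; last by rewrite mevalXU.
rewrite mevalB mevalXU -mpolyC_nat mevalC; apply: (addIr i%:R).
by rewrite subrK (Ev i ord0) // addr0.
Qed.

Lemma imPsi_vanish n (f : {mpoly K[n]}) : imPsi f -> vanish_cond p f.
Proof.
case: n f => [|n] f imf lepn v Ev.
  by have := prime_gt0 (pcharf_prime hchar); rewrite ltnNge lepn.
by rewrite meval_wheel // imPsi_wheel // meval0.
Qed.

Lemma redK_PZ n lam (H : {mpoly int[n]}) : is_PZ lam H ->
  (mulp lam)%:R * redK K H * vdm K n = alt (xmon K n lam * vdm1 K n).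
Proof.
move=> /is_PZ_alt/(congr1 (map_mpoly (intmul (1 : K)))).
by rewrite map_alt !rmorphM /= map_vdm map_vdm1 map_xmon rmorph_nat.
Qed.

(** The product of generators is [mulp lam] times [P_lam], and [mulp lam] is invertible in [K] since
    all multiplicities are below [p]. *)
Lemma imPsi_redK n lam (H : {mpoly int[n]}) :
  is_partition n lam -> p_restricted p lam -> is_PZ lam H -> imPsi (redK K H).
Proof.
move=> /andP[/eqP sz _] restr /redK_PZ EH; subst n; have [F [imF EF]] := imPsi_xmon lam.
have -> : redK K H = (mulp lam)%:R^-1 *: F.
  have /(mulIf (vdm_neq0 _ _)) <- := etrans EH (esym EF).
  by rewrite -mpolyC_nat mul_mpolyC scalerA mulVf ?scale1r ?mulp_neq0.
by move=> S clS; have [_ [_ SZ _]] := clS; exact: SZ (imF S clS).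
Qed.

End Image.

(** * Top-degree coefficients on the wheel locus *)

Section NonRoot.

(** Residues modulo [B] give the lowest digit, induction the others. This keeps distinct monomials
    distinct under a Kronecker substitution. *)
Lemma digits_inj n B (e f : 'I_n -> nat) :
  (forall i, (e i < B)%N) -> (forall i, (f i < B)%N) ->
  (\sum_i e i * B ^ i = \sum_i f i * B ^ i)%N -> e =1 f.
Proof.
elim: n e f => [|n IHn] e f lte ltf; first by move=> _ [].
have B0 : (0 < B)%N by apply: leq_trans (lte ord0).
have split_sum (g : 'I_n.+1 -> nat) :
    (\sum_i g i * B ^ i = (\sum_(i < n) g (lift ord0 i) * B ^ i) * B + g ord0)%N.
  rewrite big_ord_recl /= expn0 muln1 addnC big_distrl; congr (_ + _)%N.
  by apply: eq_bigr => i _; rewrite /= expnS mulnCA mulnC.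
rewrite !split_sum => E i.
have E0 : e ord0 = f ord0.
  by have := congr1 (modn^~ B) E; rewrite !modnMDl !modn_small.
case: (unliftP ord0 i) => [j ->|->]; last exact: E0.
apply: (IHn (e \o lift ord0) (f \o lift ord0)) => //=.
by move/eqP: E; rewrite E0 eqn_add2r eqn_pmul2r // => /eqP.
Qed.

Variable K : closedFieldType.

(* Kronecker substitution [X_i := x ^ (B ^ i)]. *)
Lemma mpoly_nonroot n (f : {mpoly K[n]}) : f != 0 -> exists v, f.@[v] != 0.
Proof.
(* [msize f] exceeds every exponent in [f], so the exponents are digits in base [B]. *)
move=> nzf; pose B := msize f; pose e (m : 'X_{1..n}) := (\sum_i m i * B ^ i)%N.
have ltB (m : 'X_{1..n}) i : m \in msupp f -> (m i < B)%N.
  move/msize_mdeg_lt; apply: leq_ltn_trans; rewrite mdegE (bigD1 i) //=; exact: leq_addr.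
have /closed_nonrootP[x nz] : \sum_(m <- msupp f) f@_m *: 'X^(e m) != 0.
  apply/eqP => /(congr1 (coefp (e (mlead f)))); rewrite /= coef_sum coef0.
  rewrite (bigD1_seq (mlead f)) ?msupp_uniq ?mlead_supp //= coefZ coefXn eqxx mulr1.
  rewrite big_seq_cond big1 ?addr0 => [/eqP|m /andP[fm neq]]; first by rewrite mleadc_eq0 (negPf nzf).
  rewrite coefZ coefXn; case: eqP => [E|_]; last by rewrite mulr0.
  case/eqP: neq; apply/mnmP => i; symmetry; apply: digits_inj E i => i; apply: ltB => //.
  exact: mlead_supp.
exists (fun i => x ^+ (B ^ i)); move: nz; rewrite rootE mevalE horner_sum.
congr (_ != 0); apply: eq_bigr => m _; rewrite hornerZ hornerXn; congr (_ * _).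
by rewrite /e -prodrXr; apply: eq_bigr => i _; rewrite mulnC exprM.
Qed.

End NonRoot.

(** * Invariant sums modulo p *)

Section PermFix.
Variables (K : fieldType) (p : nat).
Hypothesis hchar : p \in [pchar K].

(** Orbits have 1 or [p] elements and [F] is constant on each, so an orbit of size [p] contributes a
    multiple of [p], which is 0 in [K]. *)
Lemma sum_perm_fix (T : finType) (s : {perm T}) (F : T -> K) :
  (s ^+ p)%g = 1%g -> (forall x, F (s x) = F x) ->
  \sum_x F x = \sum_(x | s x == x) F x.
Proof.
move=> sp1 Fs; rewrite (bigID (fun x => s x == x)) /= [X in _ + X](_ : _ = 0) ?addr0 //.
rewrite (partition_big (porbit s) predT) //= big1 // => O _.
have [y /andP[sy /eqP <-]|none] := pickP (fun x => (s x != x) && (porbit s x == O)); last first.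
  exact: big_pred0.
have Fpow k x : F ((s ^+ k)%g x) = F x.
  by elim: k => [|k IHk]; rewrite ?expg0 ?perm1 // expgSr permM Fs.
rewrite (eq_bigl (mem (porbit s y))) => [|x]; last first.
  rewrite eq_porbit_mem andb_idl // => /porbitP[k ->].
  by rewrite -permM -expgSr expgS permM (inj_eq perm_inj).
rewrite (eq_bigr (fun=> F y)) => [|x /porbitP[k ->]]; last exact: Fpow.
rewrite sumr_const; have dvd_p : (#|porbit s y| %| p)%N.
  have dvd_s : (#[s]%g %| p)%N by rewrite order_dvdn sp1.
  by apply: dvdn_trans dvd_s; rewrite porbit.unlock; apply: (dvdn_orbit 'P).
have [_ /(_ _ dvd_p)/orP[/eqP E|/eqP->]] := primeP (pcharf_prime hchar); last first.
  exact: mulrn_pchar hchar _.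
have /card_le1P/(_ y (porbit_id s y))/(_ (s y)) : (#|porbit s y| <= 1)%N by rewrite E.
by rewrite (mem_porbit s 1) inE (negPf sy).
Qed.

End PermFix.

Section TopCoefficient.
Variables (R : idomainType) (n : nat).

Lemma msizeM_pred_le (f g : {mpoly R[n]}) : (msize (f * g) <= (msize f + msize g).-1)%N.
Proof.
have [->|nzf] := eqVneq f 0; first by rewrite mul0r msize0.
have [->|nzg] := eqVneq g 0; first by rewrite mulr0 msize0.
by rewrite msizeM.
Qed.

(** The top-degree homogeneous part of [f] is the single monomial ['X_[q]]. *)
Definition leads (f : {mpoly R[n]}) (q : 'X_{1..n}) := (msize (f - 'X_[q]) <= mdeg q)%N.

Lemma leads_msize f q : leads f q -> (msize f <= (mdeg q).+1)%N.
Proof.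
move=> lead_f; rewrite -[f](subrK 'X_[q]); apply: leq_trans (msizeD_le _ _) _.
by rewrite geq_max msizeX leqnn andbT ltnW.
Qed.

Lemma leadsM f g q r : leads f q -> leads g r -> leads (f * g) (q + r)%MM.
Proof.
move=> lf lg; rewrite /leads mpolyXD mdegD.
have -> : f * g - 'X_[q] * 'X_[r] = (f - 'X_[q]) * g + 'X_[q] * (g - 'X_[r]) by ring.
apply: leq_trans (msizeD_le _ _) _; rewrite geq_max; apply/andP; split.
  apply: leq_trans (msizeM_pred_le _ _) _; rewrite -subn1 leq_subLR add1n -addnS.
  exact: leq_add lf (leads_msize lg).
apply: leq_trans (msizeM_pred_le _ _) _; rewrite msizeX addSn /= leq_add2l.
exact: lg.
Qed.

Lemma leads1 : leads 1 0%MM.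
Proof. by rewrite /leads mpolyX0 subrr msize0. Qed.

Lemma leadsX f q k : leads f q -> leads (f ^+ k) (q *+ k)%MM.
Proof.
move=> lf; elim: k => [|k IHk]; first by rewrite expr0 mulm0n; apply: leads1.
by rewrite exprS mulmS; apply: leadsM.
Qed.

Lemma leads_coef f q m : leads f q -> (mdeg q <= mdeg m)%N -> f@_m = (q == m)%:R.
Proof.
move=> lf led; have := proj1 (msize_leP _ _) lf _ led.
by rewrite mcoeffB mcoeffX => /eqP; rewrite subr_eq0 => /eqP.
Qed.

End TopCoefficient.

Section WheelTop.
Variables (K : fieldType) (p n : nat).
Hypothesis hchar : p \in [pchar K].
Hypothesis lepn : (p <= n.+1)%N.

Let p_gt0 : (0 < p)%N. Proof. exact: prime_gt0 (pcharf_prime hchar). Qed.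

Definition collapse_ord (i : 'I_n.+1) : 'I_n.+1 := if (i < p)%N then ord0 else i.

(** The exponent of the leading monomial of ['X_[m]] on the wheel locus: the first [p] exponents are
    added up at index 0. *)
Definition collapse (m : 'X_{1..n.+1}) : 'X_{1..n.+1} :=
  (\sum_i U_(collapse_ord i) *+ m i)%MM.

Lemma mdeg_collapse m : mdeg (collapse m) = mdeg m.
Proof.
rewrite /collapse [RHS]mdegE mdeg_sum; apply: eq_bigr => i _.
by rewrite mdegMn mdeg1 mul1n.
Qed.

Lemma leads_wheel m : leads ('X_[m] \mPo wheel K p n) (collapse m).
Proof.
rewrite comp_mpolyX /collapse; apply: (big_ind2 (@leads _ _)).
- exact: leads1.
- by move=> *; apply: leadsM.
move=> i _; apply: leadsX; rewrite tnth_mktuple /collapse_ord /leads mdeg1.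
case: ifP => _; last by rewrite subrr msize0.
by rewrite addrAC subrr add0r msizeN -mpolyC_nat msizeC leq_b1.
Qed.

Definition rot_fun (i : 'I_n.+1) : 'I_n.+1 :=
  if (i < p)%N then inord (i.+1 %% p) else i.

Lemma rot_funE i : rot_fun i = (if (i < p)%N then i.+1 %% p else i)%N :> nat.
Proof.
rewrite /rot_fun; case: ifP => // _; rewrite inordK //.
by apply: leq_trans lepn; rewrite ltn_mod.
Qed.

Lemma rot_fun_lt i : (rot_fun i < p)%N = (i < p)%N.
Proof. by rewrite rot_funE; case: ifP => // _; rewrite ltn_mod. Qed.

Lemma rot_fun_inj : injective rot_fun.
Proof.
move=> i j E; have ltE : (i < p)%N = (j < p)%N by rewrite -rot_fun_lt E rot_fun_lt.
have /(congr1 val) := E; rewrite /= !rot_funE -ltE; case: ifP => [ltip|_]; last exact: val_inj.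
move/eqP; rewrite -[i.+1]addn1 -[j.+1]addn1 eqn_modDr !modn_small -?ltE // => /eqP.
exact: val_inj.
Qed.

Definition rot_perm : 'S_n.+1 := perm rot_fun_inj.

Lemma rot_permX k i : (rot_perm ^+ k)%g i = (if (i < p)%N then (i + k) %% p else i)%N :> nat.
Proof.
elim: k => [|k IHk].
  by rewrite expg0 perm1; case: ifP => // lti; rewrite addn0 modn_small.
rewrite expgSr permM permE rot_funE IHk; case: (ltnP i p) => [lti|]; last by rewrite ltnNge => ->.
by rewrite ltn_mod p_gt0 -addn1 modnDml addn1 addnS.
Qed.

Lemma rot_permXp : (rot_perm ^+ p)%g = 1%g.
Proof.
apply/permP=> i; apply: val_inj; rewrite /= rot_permX perm1.
by case: ifP => // lti; rewrite modnDr modn_small.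
Qed.

Local Notation "m # s" := [multinom m (s i) | i < n.+1]
  (at level 40, left associativity, format "m # s").

Lemma collapse_rot (m : 'X_{1..n.+1}) : collapse (m#rot_perm) = collapse m.
Proof.
rewrite /collapse [RHS](reindex_inj (@perm_inj _ rot_perm)); apply: eq_bigr => i _.
by rewrite mnmE /collapse_ord permE rot_fun_lt /rot_fun; case: ifP.
Qed.

Lemma rot_fixed (m : 'X_{1..n.+1}) (i : 'I_n.+1) : m#rot_perm = m -> (i < p)%N -> m i = m ord0.
Proof.
move=> fixm lti.
have fixX k : m ((rot_perm ^+ k)%g ord0) = m ord0.
  elim: k => [|k IHk]; first by rewrite expg0 perm1.
  by rewrite -[in RHS]IHk -{2}fixm mnmE expgSr permM.
rewrite -(fixX i); congr (m _); apply: val_inj.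
by rewrite /= rot_permX /= p_gt0 add0n modn_small.
Qed.

(** On such exponents [collapse] multiplies the common value by a positive natural number, which can
    be cancelled, and keeps the exponents of index at least [p]. *)
Lemma collapse_fixed (m q : 'X_{1..n.+1}) :
  (forall i : 'I_n.+1, (i < p)%N -> m i = m ord0) ->
  (forall i : 'I_n.+1, (i < p)%N -> q i = q ord0) ->
  collapse m = collapse q -> m = q.
Proof.
have collapseE (r : 'X_{1..n.+1}) j :
    collapse r j = (\sum_i (collapse_ord i == j) * r i)%N.
  by rewrite /collapse mnm_sumE; apply: eq_bigr => i _; rewrite mulmnE mnm1E.
move=> cm cq E; have E0 : m ord0 = q ord0.
  have coll0 (r : 'X_{1..n.+1}) : (forall i : 'I_n.+1, (i < p)%N -> r i = r ord0) ->
      collapse r ord0 = ((\sum_i (collapse_ord i == ord0)) * r ord0)%N.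
    move=> cr; rewrite collapseE big_distrl; apply: eq_bigr => i _ /=.
    rewrite /collapse_ord; case: ifP => [/cr-> //|].
    by have [-> //|_] := eqVneq i ord0.
  have := congr1 (fun r : 'X_{1..n.+1} => r ord0) E; rewrite !coll0 // => /eqP.
  rewrite eqn_pmul2l => [/eqP //|]; rewrite (bigD1 ord0) //= /collapse_ord p_gt0.
  by rewrite eqxx.
apply/mnmP => j; case: (ltnP j p) => [ltj|lej]; first by rewrite cm // cq.
have collj r : collapse r j = r j.
  rewrite collapseE (bigD1 j) //= {1}/collapse_ord ltnNge lej /= eqxx mul1n big1 ?addn0 //.
  move=> i neij; rewrite /collapse_ord; case: ifP => _; last by rewrite (negPf neij).
  by rewrite -val_eqE /= (ltn_eqF (leq_trans p_gt0 lej)).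
by rewrite -[LHS]collj E collj.
Qed.

(** The coefficient of [collapse m] on the wheel locus is the sum of [f@_q] over all [q] with the
    same collapse. Rotating the first [p] exponents preserves the summands, so only fixed [q] count
    modulo [p], and [m] is the only one. *)
Lemma wheel_top_coef (f : {mpoly K[n.+1]}) (m : 'X_{1..n.+1}) :
  f \is symmetric -> f \mPo wheel K p n = 0 -> (msize f <= (mdeg m).+1)%N ->
  (forall i : 'I_n.+1, (i < p)%N -> m i = m ord0) -> f@_m = 0.
Proof.
move=> symf fw0 ltf constm; pose d := (mdeg m).+1.
pose F (q : 'X_{1..n.+1 < d}) : K := if collapse q == collapse m then f@_q else 0.
have sumF : \sum_q F q = 0.
  have := congr1 (mcoeff (collapse m)) fw0; rewrite mcoeff0 => E; rewrite -[RHS]E.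
  rewrite (mpolywE ltf) rmorph_sum linear_sum; apply: eq_bigr => q _ /=.
  (* [leads_coef] applies because [collapse] preserves degrees and [q] has at most the degree of
     [m]. *)
  rewrite comp_mpolyZ mcoeffZ (leads_coef (leads_wheel q)).
    by rewrite /F; case: eqP; rewrite ?mulr1 ?mulr0.
  by rewrite !mdeg_collapse -ltnS bmdeg.
have ltrot (q : 'X_{1..n.+1 < d}) : (mdeg (q#rot_perm) < d)%N by rewrite mdeg_mperm bmdeg.
have injrot : injective (fun q => BMultinom (ltrot q)).
  by move=> q1 q2 /(congr1 val) /= /mperm_inj/val_inj.
pose s := perm injrot.
have sX k q : val ((s ^+ k)%g q) = (val q)#(rot_perm ^+ k)%g.
  elim: k q => [|k IHk] q; first by rewrite !expg0 perm1 mperm1.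
  by rewrite expgSr permM permE /= IHk -mpermM -expgS.
have spm : (s ^+ p)%g = 1%g.
  by apply/permP=> q; apply: val_inj; rewrite sX rot_permXp perm1 mperm1.
have Fs q : F (s q) = F q.
  by rewrite /F permE /= collapse_rot msym_coeff.
move: sumF; rewrite (sum_perm_fix hchar spm Fs).
have ltm : (mdeg m < d)%N by [].
have sm : s (BMultinom ltm) = BMultinom ltm.
  apply: val_inj; rewrite permE /=; apply/mnmP => i; rewrite mnmE permE.
  case: (ltnP i p) => lti; first by rewrite !constm // rot_fun_lt.
  by rewrite /rot_fun ltnNge lti.
rewrite (bigD1 (BMultinom ltm)) ?sm //= {1}/F eqxx big1 ?addr0 // => q /andP[/eqP sq neq].
rewrite /F; case: eqP => // Eq; case/eqP: neq; apply: val_inj => /=.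
apply: collapse_fixed => // i; apply: rot_fixed.
by have /(congr1 val) := sq; rewrite permE.
Qed.

End WheelTop.

(** * The basis *)

Local Notation "m # s" := [multinom m (s i) | i < _]
  (at level 40, left associativity, format "m # s").

Definition mon n (lam : seq nat) : 'X_{1..n} := [multinom nth 0%N lam i | i < n].

Lemma xmonE (R : comNzRingType) n lam : xmon R n lam = 'X_[mon n lam].
Proof. by rewrite mpolyXE_id; apply: eq_bigr => i _; rewrite mnmE. Qed.

(** Partitions index the orbits of exponents under permutation, the decreasing rearrangement being
    the representative. *)
Lemma mon_perm n (lam : seq nat) (m : 'X_{1..n}) : is_partition n lam ->
  reflect (exists s : 'S_n, mon n lam = m#s) (sort geq m == lam).
Proof.
case/andP=> /eqP sz srt.
have geq_total : total geq by move=> x y; apply: leq_total.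
have geq_trans : transitive geq by apply: rev_trans leq_trans.
have geq_anti : antisymmetric geq by move=> x y; rewrite andbC => /anti_leq.
apply: (iffP eqP) => [E|[s Es]].
  have /tuple_permP[s Es] : perm_eq lam (multinom_val m) by rewrite -E perm_sort.
  exists s; apply/mnmP => i; rewrite !mnmE Es -tnth_nth tnth_mktuple.
  by [].
apply: (sorted_eq geq_trans geq_anti) => //; first exact: sort_sorted.
rewrite perm_sort perm_sym; apply/(@tuple_permP _ _ _ (multinom_val m)); exists s.
apply: (@eq_from_nth _ 0%N) => [|i]; rewrite ?size_tuple sz // => lti.
have /(congr1 (fun q : 'X_{1..n} => q (Ordinal lti))) := Es; rewrite !mnmE /= => ->.
by rewrite (nth_map (Ordinal lti)) ?size_enum_ord // (nth_ord_enum _ (Ordinal lti)).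
Qed.

Lemma mon_sort n (m : 'X_{1..n}) : is_partition n (sort geq m) /\
  exists s : 'S_n, mon n (sort geq m) = m#s.
Proof.
have part : is_partition n (sort geq m).
  by rewrite /is_partition size_sort size_tuple eqxx sort_sorted // => x y; apply: leq_total.
by apply: (conj part); apply/(mon_perm _ part).
Qed.

(** * Stabilizers of exponents *)

Section Young.
Variables (n p : nat) (q : 'X_{1..n}).

(** The Young subgroup stabilizing [q]; its order is the coefficient of ['X_[q]] in the
    symmetrization of that monomial. *)
Definition young := [set s : 'S_n | [forall i, q (s i) == q i]].

Lemma youngP (s : 'S_n) : reflect (forall i, q (s i) = q i) (s \in young).
Proof. by rewrite inE; apply: (iffP forallP) => H i; apply/eqP; rewrite H. Qed.

Lemma youngE : [set s : 'S_n | q == q#s] = young.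
Proof.
apply/setP => s; rewrite inE; apply/eqP/youngP => [E i|E]; last first.
  by apply/mnmP => i; rewrite mnmE E.
by rewrite {2}E mnmE.
Qed.

Lemma young_group_set : group_set young.
Proof.
apply/group_setP; split=> [|s t /youngP ys /youngP yt]; apply/youngP => i.
  by rewrite perm1.
by rewrite permM yt.
Qed.

(** Otherwise Cauchy's theorem gives an element of order [p]. A nontrivial orbit of it has [p]
    elements and lies in a level set of [q], which is too small. *)
Lemma young_prime : prime p ->
  (forall a, (#|[set i | q i == a]| < p)%N) -> ~~ (p %| #|young|)%N.
Proof.
move=> pr_p lt_p; apply/negP => /(@Cauchy _ p (Group young_group_set) pr_p)[s ys os].
have [i si|fix_s] := pickP (fun i => s i != i); last first.
  have s1 : s = 1%g by apply/permP => i; rewrite perm1; apply/eqP/negbFE/fix_s.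
  by move: pr_p; rewrite -os s1 order1.
have dvd_p : (#|porbit s i| %| p)%N by rewrite -os porbit.unlock; apply: (dvdn_orbit 'P).
have [_ /(_ _ dvd_p)/orP[/eqP E|/eqP E]] := primeP pr_p.
  have /card_le1P/(_ i (porbit_id s i))/(_ (s i)) : (#|porbit s i| <= 1)%N by rewrite E.
  by rewrite (mem_porbit s 1) inE (negPf si).
have := lt_p (q i); rewrite ltnNge -E subset_leq_card //.
apply/subsetP => _ /porbitP[k ->]; rewrite inE; apply/eqP.
by elim: k => [|k IHk]; rewrite ?expg0 ?perm1 // expgSr permM (youngP _ ys).
Qed.

End Young.

Lemma card_mon_eq n lam a : size lam = n -> #|[set i : 'I_n | mon n lam i == a]| = count_mem a lam.
Proof.
move=> sz; rewrite -sum1_count (big_nth 0%N) sz big_mkord -sum1dep_card.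
by apply: eq_bigl => i; rewrite mnmE.
Qed.

(** * Leading coefficients of [P_lam] *)

Section Leading.
Variables (K : fieldType) (p : nat).
Hypothesis hchar : p \in [pchar K].

(** By [alt_vdm1_lead], [mulp lam] times [P_lam] agrees with the symmetrized monomial from degree
    [mdeg (mon n lam)] upwards. *)
Lemma PZ_coef n lam (H : {mpoly int[n]}) (m : 'X_{1..n}) : is_PZ lam H ->
  (mdeg (mon n lam) <= mdeg m)%N ->
  (mulp lam)%:R * (redK K H)@_m = #|[set s : 'S_n | mon n lam == m#s]|%:R.
Proof.
move=> /(redK_PZ K) EH led.
have nz : xmon K n lam != 0 by rewrite xmonE -msize_poly_eq0 msizeX.
have := alt_vdm1_lead nz (esym EH); rewrite {2}xmonE msizeX ltnS => /msize_leP/(_ m led).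
rewrite mcoeffB -mpolyC_nat mcoeffCM => /eqP; rewrite subr_eq0 => /eqP ->.
rewrite linear_sum -sum1dep_card natr_sum [RHS]big_mkcond /=; apply: eq_bigr => s _.
by rewrite xmonE mcoeff_sym mcoeffX; case: (_ == _).
Qed.

(** If the coefficient were 0, [PZ_coef] would make [p] divide the order of the stabilizer, against
    [young_prime]. *)
Lemma PZ_coef_neq0 n lam (H : {mpoly int[n]}) :
  is_partition n lam -> p_restricted p lam -> is_PZ lam H -> (redK K H)@_(mon n lam) != 0.
Proof.
move=> /andP[/eqP sz _] restr EH; have := PZ_coef EH (leqnn _).
rewrite youngE => E.
apply: contraNneq (young_prime (q := mon n lam) (pcharf_prime hchar) _).
  by move=> z; rewrite (dvdn_pcharf hchar) -E z mulr0.
move=> a; rewrite card_mon_eq //; have [/(allP restr) //|/count_memPn->] := boolP (a \in lam).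
exact: prime_gt0 (pcharf_prime hchar).
Qed.

Lemma PZ_coef_eq0 n lam (H : {mpoly int[n]}) (m : 'X_{1..n}) :
  is_partition n lam -> p_restricted p lam -> is_PZ lam H ->
  (mdeg (mon n lam) <= mdeg m)%N -> sort geq m != lam -> (redK K H)@_m = 0.
Proof.
move=> part restr EH led neq; have /eqP := PZ_coef EH led.
rewrite (_ : [set s | _] = set0) ?cards0.
  by rewrite mulf_eq0 (negPf (mulp_neq0 hchar restr)) => /eqP.
apply/setP => s; rewrite !inE; apply/negP => /eqP E; case/negP: neq.
by apply/(mon_perm _ part); exists s.
Qed.

End Leading.

Lemma imPsiZ (K : fieldType) n (a : K) (f : {mpoly K[n]}) : imPsi f -> imPsi (a *: f).
Proof. by move=> imf S clS; have [_ [_ SZ _]] := clS; exact: SZ (imf S clS). Qed.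

Lemma imPsi_sum (K : fieldType) n (I : Type) (r : seq I) (P : pred I) (F : I -> {mpoly K[n]}) :
  (forall i, P i -> imPsi (F i)) -> imPsi (\sum_(i <- r | P i) F i).
Proof.
move=> imF S clS; have [[_ _ S0] [SD _ _]] := clS.
by apply: big_ind => [||i /imF]; [apply: S0 | apply: SD | apply].
Qed.

(** Restating [is_PZ] as a boolean equation through [is_PZ_alt] lets [xchoose] select the
    witnesses. *)
Lemma PZ_choice : exists Pz : forall k : nat, seq nat -> {mpoly int[k]},
  forall k lam, is_partition k lam -> is_PZ lam (Pz k lam).
Proof.
pose Q k lam (H : {mpoly int[k]}) := ~~ is_partition k lam ||
  ((mulp lam)%:R * H * vdm int k == alt (xmon int k lam * vdm1 int k)).
have exQ k lam : exists H, Q k lam H.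
  have [part|npart] := boolP (is_partition k lam); last by exists 0; rewrite /Q npart.
  by have [H /is_PZ_alt EH] := is_PZ_exists part; exists H; rewrite /Q EH eqxx orbT.
exists (fun k lam => xchoose (exQ k lam)) => k lam part.
by case/orP: (xchooseP (exQ k lam)) => [/negP//|/eqP/is_PZ_alt].
Qed.

(** * Linear independence and spanning *)

Section Basis.
Variables (K : closedFieldType) (p : nat).
Hypothesis hchar : p \in [pchar K].

Let p_gt0 : (0 < p)%N. Proof. exact: prime_gt0 (pcharf_prime hchar). Qed.

(** If the substituted polynomial were nonzero, it would be nonzero at some [v]; but the wheel
    substitution sends [v] into the locus, where [f] vanishes. *)
Lemma vanish_wheel n (f : {mpoly K[n.+1]}) : (p <= n.+1)%N -> vanish_cond p f ->
  f \mPo wheel K p n = 0.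
Proof.
move=> lepn vf; apply/eqP/negPn/negP => /mpoly_nonroot[v].
rewrite comp_mpoly_meval vf ?eqxx // => i j lti ltj; rewrite !tnth_mktuple lti ltj.
by rewrite !mevalB -!mpolyC_nat !mevalC !subrK.
Qed.

(** If a value occurs [p] times in [m], symmetry allows moving these occurrences to the front, where
    [wheel_top_coef] kills the coefficient. *)
Lemma restricted_top n (f : {mpoly K[n]}) (m : 'X_{1..n}) :
  f \is symmetric -> vanish_cond p f -> (msize f <= (mdeg m).+1)%N ->
  f@_m != 0 -> p_restricted p (sort geq m).
Proof.
move=> symf vf lef; apply: contraNT => /allPn[a _]; rewrite -leqNgt => lepa.
have {lepa}lepa : (p <= count_mem a m)%N by rewrite (seq.permP (permEl (perm_sort geq m))) in lepa.
have lepn : (p <= n)%N by rewrite (leq_trans lepa) // -[n in leqRHS](size_tuple m) count_size.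
case: n => [|n] in f m symf vf lef lepa lepn *; first by move: p_gt0; rewrite ltnNge lepn.
(* The exponents of [m] rearranged with all copies of [a] first. *)
pose t := filter (pred1 a) m ++ filter (predC (pred1 a)) m.
have /tuple_permP[s Es] : perm_eq t (multinom_val m) by rewrite (permEl (perm_filterC _ _)).
have ms i : (m#s) i = nth 0%N t i.
  by rewrite mnmE Es (nth_map i) ?size_enum_ord // (nth_ord_enum _ i).
have msa (i : 'I_n.+1) : (i < p)%N -> (m#s) i = a.
  move=> lti; have lti_count : (i < size (filter (pred1 a) m))%N.
    by rewrite size_filter (leq_trans lti).
  rewrite ms nth_cat lti_count.
  by have := mem_nth 0%N lti_count; rewrite mem_filter => /andP[/eqP].
rewrite -(msym_coeff m s symf) (wheel_top_coef hchar lepn symf (vanish_wheel lepn vf)) //.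
  by rewrite mdeg_mperm.
by move=> i lti; rewrite !msa.
Qed.

Variable Pz : forall k : nat, seq nat -> {mpoly int[k]}.
Hypothesis PzP : forall k lam, is_partition k lam -> p_restricted p lam -> is_PZ lam (Pz k lam).

(** Downward induction on the degree of [lam]: in the coefficient at [mon k lam], terms of higher
    degree vanish by induction and the other terms with [mu != lam] by [PZ_coef_eq0]. *)
Lemma PZ_free k (s : seq (seq nat)) (c : seq nat -> K) :
  uniq s -> all (fun lam => is_partition k lam && p_restricted p lam) s ->
  \sum_(lam <- s) c lam *: redK K (Pz k lam) = 0 ->
  forall lam, lam \in s -> c lam = 0.
Proof.
move=> us /allP oks sum0 lam slam.
pose D := (\max_(mu <- s) mdeg (mon k mu))%N.
have leD mu : mu \in s -> (mdeg (mon k mu) <= D)%N.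
  by move=> smu; rewrite /D (big_rem mu) //= leq_maxl.
have [N] := ubnP (D - mdeg (mon k lam))%N; elim: N => // N IHN in lam slam *.
rewrite ltnS => leN; have /andP[part restr] := oks _ slam.
have := congr1 (mcoeff (mon k lam)) sum0; rewrite linear_sum mcoeff0 /=.
rewrite (bigD1_seq lam) //= big_seq_cond big1 ?addr0 => [|mu /andP[smu neq]].
  rewrite mcoeffZ => /eqP; rewrite mulf_eq0.
  by rewrite (negPf (PZ_coef_neq0 hchar part restr (PzP part restr))) orbF => /eqP.
have /andP[partmu restrmu] := oks _ smu; rewrite mcoeffZ.
have [le|lt] := leqP (mdeg (mon k mu)) (mdeg (mon k lam)).
  rewrite (PZ_coef_eq0 hchar partmu restrmu (PzP partmu restrmu) le) ?mulr0 //.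
  apply: contra_neq neq => <-; apply/eqP/(mon_perm _ part); exists 1%g.
  by apply/mnmP => i; rewrite !mnmE perm1.
rewrite (IHN mu smu) ?mul0r //; apply: leq_trans leN.
by rewrite ltn_sub2l // (leq_trans lt) // leD.
Qed.

(** Induction on the degree: subtracting multiples of [P_lam] removes the top-degree part, and the
    remainder is again symmetric and vanishes on the locus since each [P_lam] is in the image. *)
Lemma PZ_span k (f : {mpoly K[k]}) : f \is symmetric -> vanish_cond p f ->
  exists (s : seq (seq nat)) (c : seq nat -> K),
    all (fun lam => is_partition k lam && p_restricted p lam) s /\
    f = \sum_(lam <- s) c lam *: redK K (Pz k lam).
Proof.
move=> symf vf.
(* The added degree bound keeps the partitions of successive steps apart. *)
suff /(_ _ _ (leqnn (msize f)) symf vf)[s [c [Hs _ E]]] : forall d (f : {mpoly K[k]}),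
    (msize f <= d)%N -> f \is symmetric -> vanish_cond p f ->
    exists (s : seq (seq nat)) (c : seq nat -> K),
    [/\ all (fun lam => is_partition k lam && p_restricted p lam) s,
        all (fun lam => (mdeg (mon k lam) < d)%N) s
      & f = \sum_(lam <- s) c lam *: redK K (Pz k lam)] by exists s, c.
elim=> [|d IHd] {symf vf}f lef symf vf.
  exists [::], (fun=> 0); split=> //; rewrite big_nil; apply/eqP.
  by rewrite -msize_poly_eq0 -leqn0.
pose T := undup [seq sort geq (multinom_val m) | m <- [seq m <- msupp f | mdeg m == d]].
have TP lam : reflect (exists m, [/\ f@_m != 0, mdeg m = d & lam = sort geq m]) (lam \in T).
  rewrite mem_undup; apply: (iffP mapP) => [[m]|[m [fm dm ->]]].
    by rewrite mem_filter mcoeff_msupp => /andP[/eqP dm fm] ->; exists m.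
  by exists m => //; rewrite mem_filter mcoeff_msupp fm dm eqxx.
have Tok lam : lam \in T -> [/\ is_partition k lam, p_restricted p lam & mdeg (mon k lam) = d].
  case/TP=> m [fm dm ->]; have [part [s Es]] := mon_sort m.
  by split=> //; [apply: restricted_top fm; rewrite // dm | rewrite Es mdeg_mperm].
(* Chosen so that [f] and [g] have the same coefficients in degree [d]. *)
pose c0 lam := f@_(mon k lam) / (redK K (Pz k lam))@_(mon k lam).
pose g := \sum_(lam <- T) c0 lam *: redK K (Pz k lam).
have img : imPsi g.
  rewrite /g big_seq; apply: imPsi_sum => lam /Tok[part restr _]; apply: imPsiZ.
  exact (imPsi_redK hchar part restr (PzP part restr)).
have sym_g := imPsi_symmetric img; have v_g := imPsi_vanish hchar img.
have [||| s [c [Hs Hd E]]] := IHd (f - g).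
- apply/msize_leP => m led; have [part [s Es]] := mon_sort m.
  have neq_coef lam : lam \in T -> lam != sort geq m -> (redK K (Pz k lam))@_m = 0.
    move=> /Tok[partl restrl dl] neq; apply: (PZ_coef_eq0 hchar partl restrl (PzP partl restrl)).
      by rewrite dl.
    by rewrite eq_sym.
  rewrite mcoeffB /g linear_sum /=; have [Tm|nTm] := boolP (sort geq m \in T).
    have [_ restr _] := Tok _ Tm; rewrite (bigD1_seq (sort geq m)) ?undup_uniq //=.
    rewrite big_seq_cond big1 ?addr0 => [|lam /andP[Tlam neq]]; last first.
      by rewrite mcoeffZ neq_coef ?mulr0.
    have symP := imPsi_symmetric (imPsi_redK hchar part restr (PzP part restr)).
    rewrite mcoeffZ /c0 Es !msym_coeff // divfK ?subrr //.
    rewrite -(msym_coeff m s symP) -Es.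
    exact (PZ_coef_neq0 hchar part restr (PzP part restr)).
  rewrite big_seq big1 ?subr0 => [|lam Tlam]; last first.
    by rewrite mcoeffZ neq_coef ?mulr0 //; apply: contraNneq nTm => <-.
  have [dm|neq] := eqVneq (mdeg m) d; last first.
    by apply: (proj1 (msize_leP f d.+1)) => //; rewrite ltn_neqAle eq_sym neq.
  by apply/eqP; apply: contraNT nTm => fm; apply/TP; exists m.
- by rewrite rpredB.
- by move=> lepk v Ev; rewrite mevalB vf // v_g // subrr.
(* Partitions in [T] have degree [d] and those in [s] smaller degree, so the degree decides which
   coefficient function to use. *)
exists (T ++ s), (fun lam => if mdeg (mon k lam) == d then c0 lam else c lam); split.
- by rewrite all_cat Hs andbT; apply/allP => lam /Tok[-> ->].
- rewrite all_cat; apply/andP; split; first by apply/allP => lam /Tok[_ _ ->].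
  by apply: sub_all Hd => lam /ltnW.
rewrite big_cat -[LHS](subrK g) addrC E /=; congr (_ + _).
  by apply: eq_big_seq => lam /Tok[_ _ ->]; rewrite eqxx.
by apply: eq_big_seq => lam /(allP Hd) ltd; rewrite (ltn_eqF ltd).
Qed.

End Basis.

Theorem theorem3p3 (K : closedFieldType) (p : nat)
  (hchar : p \in [pchar K]) (hp2 : (2 < p)%N) :
  (* description of im(Psi_K), degree by degree *)
  (forall (k : nat) (f : {mpoly K[k]}),
      imPsi f <-> (f \is symmetric /\ vanish_cond p f)) /\
  (* P_lambda is an integer polynomial *)
  (forall (k : nat) (lam : seq nat), is_partition k lam -> p_restricted p lam ->
      exists H : {mpoly int[k]}, is_PZ lam H) /\
  (* the P_lambda, lambda p-restricted, form a basis of im(Psi_K) *)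
  (forall Pz : forall k : nat, seq nat -> {mpoly int[k]},
      (forall k lam, is_partition k lam -> p_restricted p lam -> is_PZ lam (Pz k lam)) ->
      forall k : nat,
        (forall lam, is_partition k lam -> p_restricted p lam ->
            imPsi (redK K (Pz k lam))) /\
        (forall (s : seq (seq nat)) (c : seq nat -> K),
            uniq s -> all (fun lam => is_partition k lam && p_restricted p lam) s ->
            \sum_(lam <- s) c lam *: redK K (Pz k lam) = 0 ->
            forall lam, lam \in s -> c lam = 0) /\
        (forall f : {mpoly K[k]}, imPsi f ->
            exists (s : seq (seq nat)) (c : seq nat -> K),
              all (fun lam => is_partition k lam && p_restricted p lam) s /\
              f = \sum_(lam <- s) c lam *: redK K (Pz k lam))).
Proof.
have imP k (f : {mpoly K[k]}) : imPsi f <-> (f \is symmetric /\ vanish_cond p f).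
  split=> [imf|[symf vf]].
    by split; [apply: imPsi_symmetric imf | exact (imPsi_vanish hchar imf)].
  (* The converse inclusion needs some family of [P_lam]; any choice will do. *)
  have [Pz PzP] := PZ_choice.
  have [s [c [/allP oks ->]]] := PZ_span hchar (fun k lam part _ => PzP k lam part) symf vf.
  rewrite big_seq; apply: imPsi_sum => lam /oks/andP[part restr]; apply: imPsiZ.
  exact (imPsi_redK hchar part restr (PzP _ _ part)).
split=> //; split=> [k lam part _|Pz PzP k]; first exact: is_PZ_exists.
split=> [lam part restr|]; first exact (imPsi_redK hchar part restr (PzP _ _ part restr)).
split=> [s c|f /imP[symf vf]]; first exact (@PZ_free K p hchar Pz PzP k s c).
exact (PZ_span hchar PzP symf vf).
Qed.
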